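(* Let $\mathbf{p}=(p_i)_{i\ge1}$ with $p_1=0$, $p_2=1$, $p_i\in(0,1)$ for $i\ge 3$, let $q_i=1-p_i$, $\bar q_n=\sum_{i=1}^nq_i$, and let $K_n$ be the number of cycles of the random derangement process $X^{n,\mathbf{p}}$. Suppose $nq_n\to\theta>0$. Then $(K_n-\bar q_n)/\sqrt{\bar q_n}\Rightarrow\mathcal{N}$ as $n\to\infty$, where $\mathcal{N}$ is standard normal. Furthermore, if $|\psi_\theta(\mathbf{p})|<\infty$, where $\psi_\theta(\mathbf{p})=\sum_{i=1}^\infty\left(q_i-\frac{\theta}{i}\right)$ (i.e. this series converges to a finite limit), then, as $n\to\infty$, $$\frac{K_n-\theta\log n}{\sqrt{\theta\log n}}\Rightarrow\mathcal{N}.$$ In particular, the last convergence holds if there exists $c>0$ such that $|\theta_n-\theta|\asymp n^{-c}$, where $\theta_n=(n-1)q_n/p_n$ for $n\ge3$ (equivalently $p_n=\frac{n-1}{n-1+\theta_n}$).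
   Context: Random derangement process: for $n\ge 2$, $X^{n,\mathbf{p}}=(X_{n+1}=1,X_n,\dots,X_1)$ is the $\{0,1\}$-valued inhomogeneous Markov chain, run in decreasing index and started from $X_{n+1}=1$, such that $X_n=0$ a.s., $X_1=1$ a.s., and for $2\le r\le n-1$: $\mathbb{P}(X_r=0\mid X_{r+1}=0)=p_r$, $\mathbb{P}(X_r=1\mid X_{r+1}=0)=q_r$, $\mathbb{P}(X_r=0\mid X_{r+1}=1)=1$. The number of cycles is $K_n=\sum_{i=1}^nX_i$. $\Rightarrow$ denotes convergence in distribution; $a_n\asymp b_n$ means that $a_n/b_n$ is bounded above and below by positive constants for large $n$. *)

(* Defs.v *)
From HB Require Import structures.
From mathcomp Require Import all_boot all_order all_algebra.
From mathcomp Require Import all_classical all_reals all_analysis.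
From mathcomp Require Import measurable_realfun.
Import Order.TTheory GRing.Theory Num.Theory.
Import numFieldNormedType.Exports.

Set Implicit Arguments.
Unset Strict Implicit.
Unset Printing Implicit Defensive.

Local Open Scope classical_set_scope.
Local Open Scope ring_scope.

(* Sequences indexed by i >= 1 are functions on [nat] whose value at 0 is
   never used. *)
Section parameters.
Context {R : realType}.
Implicit Types (p : nat -> R) (theta : R).

Definition qcoef p (i : nat) : R := 1 - p i.

Definition qbar p (n : nat) : R := \sum_(1 <= i < n.+1) qcoef p i.

Definition psi_partial theta p (n : nat) : R :=
  \sum_(1 <= i < n.+1) (qcoef p i - theta / i%:R).

Definition theta_coef p (n : nat) : R := (n%:R - 1) * qcoef p n / p n.

Definition asymp_equiv (a b : nat -> R) : Prop :=
  exists c C : R, [/\ 0 < c, 0 < C & \forall n \near \oo, c <= a n / b n <= C].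

End parameters.

Section derangement.
Context {d : measure_display} {T : measurableType d} {R : realType}.
Variable P : probability T R.

(* Only meaningful when [P B != 0]; every use below is guarded. *)
Definition cond_prob (A B : set T) : R := fine (P (A `&` B)) / fine (P B).

Definition ev (X : nat -> {RV P >-> bool}) (i : nat) (b : bool) : set T :=
  [set t | X i t = b].

Definition history (X : nat -> {RV P >-> bool}) (n r : nat) (x : nat -> bool) :
    set T :=
  [set t | forall j, (r < j <= n.+1)%N -> X j t = x j].

(* [false], [true] are the states 0, 1.  Only X 1, ..., X n.+1 are constrained.
   Conditional probabilities given a null event carry no constraint: for
   instance X_n = 1 has probability 0. *)
Record derangement_process (n : nat) (p : nat -> R)
    (X : nat -> {RV P >-> bool}) : Prop := DerangementProcess {
  dp_markov : forall (r : nat) (x : nat -> bool), (1 <= r <= n)%N ->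
    P (history X n r x) != 0%E ->
    cond_prob (ev X r (x r)) (history X n r x) =
    cond_prob (ev X r (x r)) (ev X r.+1 (x r.+1));
  dp_start : {ae P, forall t, X n.+1 t = true};
  dp_first : {ae P, forall t, X n t = false};
  dp_last : {ae P, forall t, X 1%N t = true};
  dp_00 : forall r, (2 <= r <= n.-1)%N -> P (ev X r.+1 false) != 0%E ->
    cond_prob (ev X r false) (ev X r.+1 false) = p r;
  dp_01 : forall r, (2 <= r <= n.-1)%N -> P (ev X r.+1 false) != 0%E ->
    cond_prob (ev X r true) (ev X r.+1 false) = qcoef p r;
  dp_10 : forall r, (2 <= r <= n.-1)%N -> P (ev X r.+1 true) != 0%E ->
    cond_prob (ev X r false) (ev X r.+1 true) = 1
}.

Definition cycles (X : nat -> {RV P >-> bool}) (n : nat) (t : T) : R :=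
  \sum_(1 <= i < n.+1) (X i t)%:R.

Lemma measurable_cycles X n : measurable_fun setT (cycles X n).
Proof.
apply: (@measurable_sum _ _ _ _ _ _ (fun i t => (X i t)%:R)) => i.
exact: (@measurableT_comp _ _ _ _ _ _ (fun b : bool => b%:R : R)).
Qed.

HB.instance Definition _ X n :=
  isMeasurableFun.Build _ _ _ _ (cycles X n) (measurable_cycles X n).

Definition normalized (Y : {RV P >-> R}) (a s : R) (t : T) : R := (Y t - a) / s.

Lemma measurable_normalized Y a s : measurable_fun setT (normalized Y a s).
Proof.
apply: measurable_funM => //.
exact: measurable_funB.
Qed.

HB.instance Definition _ Y a s :=
  isMeasurableFun.Build _ _ _ _ (normalized Y a s) (measurable_normalized Y a s).

End derangement.

(* The random variables Y n may live on different probability spaces. *)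
Definition cvg_in_distribution {R : realType} {d : nat -> measure_display}
    {T : forall n, measurableType (d n)} (P : forall n, probability (T n) R)
    (Y : forall n, {RV (P n) >-> R}) (nu : probability (measurableTypeR R) R) :
    Prop :=
  forall x : R, {for x, continuous (fun y : R => nu `]-oo, y]%classic)} ->
    cdf (Y n) x @[n --> \oo] --> nu `]-oo, x]%classic.

Arguments cvg_in_distribution {R d T} P Y nu.
Arguments normalized {d T R} P Y a s t.

(* Main.v *)
Require Import Defs.
From HB Require Import structures.
From mathcomp Require Import all_boot all_order all_algebra.
From mathcomp Require Import all_classical all_reals all_analysis.
From mathcomp Require Import measurable_realfun.
From mathcomp Require Import ring lra zify.
Import Order.TTheory GRing.Theory Num.Theory.
Import numFieldNormedType.Exports.

Set Implicit Arguments.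
Unset Strict Implicit.
Unset Printing Implicit Defensive.

Local Open Scope classical_set_scope.
Local Open Scope ring_scope.

(** Lindeberg's method with an explicit solution of the heat equation.  Let Phi
    be the standard normal distribution function.  The function
    heat b s x = Phi ((b - x) / sqrt s) satisfies d/ds = 1/2 d^2/dx^2 and, for s
    bounded away from 0, has bounded derivatives of every order; heat b e is a
    smoothing of the indicator of ]-oo, b].

    Write m_r = q_1 + ... + q_r.  If the chain is at state 0 at time r + 1 and
    k cycles have been counted so far, the conditional expectation of
    heat b e ((K_n - a) / s) is close to
    V r k = heat b (e + m_r / s^2) ((k + m_r - a) / s); after state 1 it is close
    to V r.-1 k.  The exact expectations satisfy
    E r k = p_r E r.-1 k + q_r E r.-2 k.+1, and a Taylor expansion shows that V
    satisfies this recursion up to an error of order q_r / s^3 +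
    q_r (q_r + q_{r-1}) / s.  As q_r = O(1/r), the errors add up to o(1), so
    P(K_n <= a + x s) is compared with V (n-1) 0, which tends to
    Phi (x / sqrt (1 + e)); finally e -> 0. *)

(** * Mean value and Taylor estimates *)

(** Mean value inequality for unordered endpoints. Derivatives are only required on the segment,
    because those of [heat] in s are controlled only for s >= e. *)
Lemma le_normB_segment (R : realType) (f df : R -> R) (B a b : R) :
  (forall t : R, Num.min a b <= t <= Num.max a b ->
     is_derive t (1 : R) f (df t) /\ `|df t| <= B) ->
  `|f b - f a| <= B * `|b - a|.
Proof.
wlog ab : a b / a <= b => [H|].
  have /orP[ab|ba] := le_total a b; first exact: H.
  by rewrite minC maxC (distrC (f b)) (distrC b); exact: (H b a ba).
rewrite min_l// max_r// => Df.
have cf : {within `[a, b], continuous f}.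
  apply: continuous_in_subspaceT => t /set_mem/= tab.
  apply: differentiable_continuous; apply/derivable1_diffP.
  by have [[]] := Df _ tab.
have [||c cab ->] := @MVT_segment _ f df a b ab => //.
  by move=> t /subset_itv_oo_cc /Df[].
by rewrite normrM ler_wpM2r//; have [] := Df _ cab.
Qed.

Lemma le_normB_of_derive (R : realType) (f df : R -> R) (B y : R) :
  (forall t : R, `|t| <= `|y| -> is_derive t (1 : R) f (df t)) ->
  (forall t : R, `|t| <= `|y| -> `|df t| <= B) ->
  `|f y - f 0| <= B * `|y|.
Proof.
move=> Df dfB; rewrite -{2}[y]subr0; apply: le_normB_segment => t ty.
suff ty' : `|t| <= `|y| by split; [exact: Df|exact: dfB].
move: ty; have [y0|y0] := leP 0 y => /andP[t1 t2].
  by rewrite !ger0_norm.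
by rewrite ler0_norm// ltr0_norm// lerN2.
Qed.

Lemma taylor2_bound (R : realType) (f f1 f2 f3 : R -> R) (M x y : R) :
  (forall t : R, is_derive t (1 : R) f (f1 t)) ->
  (forall t : R, is_derive t (1 : R) f1 (f2 t)) ->
  (forall t : R, is_derive t (1 : R) f2 (f3 t)) ->
  (forall t, `|f3 t| <= M) ->
  `|f (x + y) - f x - y * f1 x - y ^+ 2 / 2 * f2 x| <= M * `|y| ^+ 3.
Proof.
move=> D1 D2 D3 f3M.
have sh (g dg : R -> R) (t : R) : (forall u : R, is_derive u (1 : R) g (dg u)) ->
    is_derive t (1 : R) (fun u => g (x + u)) (dg (x + t)).
  move=> Dg; have -> : dg (x + t) = dg (x + t) * (0 + 1) by rewrite add0r mulr1.
  exact: is_derive1_comp.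
have r2 (t : R) : `|t| <= `|y| -> `|f2 (x + t) - f2 x| <= M * `|y|.
  move=> ty; have := @le_normB_of_derive _ (fun u => f2 (x + u)) _ M t
    (fun u _ => sh _ _ u D3) (fun u _ => f3M _).
  rewrite addr0 => /le_trans; apply; rewrite ler_wpM2l//.
  exact: le_trans (f3M 0).
have r1 (t : R) : `|t| <= `|y| -> `|f1 (x + t) - f1 x - t * f2 x| <= M * `|y| ^+ 2.
  move=> ty.
  have := @le_normB_of_derive _ (fun u => f1 (x + u) - u * f2 x)
    (fun u => f2 (x + u) - f2 x) (M * `|y|) t.
  rewrite addr0 mul0r subr0 addrAC => H.
  apply: le_trans (H _ _) _.
  - move=> u uy; have Du := sh _ _ u D2.
    apply: is_derive_eq.
    by rewrite /GRing.scale/=; ring.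
  - by move=> u ut; apply: r2; exact: le_trans ut ty.
  - rewrite expr2 mulrA ler_wpM2l// mulr_ge0//; exact: le_trans (f3M 0).
have := @le_normB_of_derive _ (fun u => f (x + u) - u * f1 x - u ^+ 2 / 2 * f2 x)
    (fun u => f1 (x + u) - f1 x - u * f2 x) (M * `|y| ^+ 2) y.
rewrite addr0 !mul0r expr0n/= !mul0r !subr0 -[_ * `|y|]mulrA -exprSr => H.
set A := (X in `|X| <= _); set A' := (X in `|X| <= _) in H.
have -> : A = A' by rewrite /A /A'; ring.
apply: H => //.
move=> u uy; have Du := sh _ _ u D1.
apply: is_derive_eq.
by rewrite /GRing.scale/=; field.
Qed.

(** * The standard normal density and distribution function *)

Section normal_cdf.
Context {R : realType}.
Implicit Types x y b s : R.

Definition phi x : R := normal_pdf 0 1 x.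

Definition Phi x : R := fine (normal_prob 0 1 `]-oo, x]%classic : \bar R).

Lemma phiE x : phi x = normal_peak 1 * expR (- (x ^+ 2 / 2)).
Proof. by rewrite /phi normal_pdfE ?oner_neq0// /normal_fun subr0 expr1n mulNr. Qed.

Global Instance is_derive_Phi x : is_derive x (1 : R) Phi (phi x).
Proof.
(* The fundamental theorem of calculus is used on the half-line up to x + 1, so that x is an
   interior point. *)
have [| | | |D dE] := @continuous_FTC1 R (normal_pdf 0 1) (BInfty _ true) x (x + 1).
- by rewrite ltrDl.
- apply: (integrableS _ _ (subsetT _)) => //.
  exact: (@integrable_normal_pdf R 0 1).
- by rewrite ltNyr.
- by apply: continuous_normal_pdf; rewrite oner_neq0.
- by constructor; [exact: D|rewrite -derive1E].
Qed.

Global Instance is_derive_phi x : is_derive x (1 : R) phi (- (x * phi x)).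
Proof.
have -> : phi = (fun x => normal_peak 1 * expR (- (x ^+ 2 / 2))).
  by apply/funext => t; exact: phiE.
apply: is_derive_eq.
by rewrite /GRing.scale/=; field.
Qed.

Lemma Phi_ge0 x : 0 <= Phi x.
Proof. by rewrite /Phi fine_ge0. Qed.

Lemma PhiE x : normal_prob 0 1 `]-oo, x]%classic = (Phi x)%:E.
Proof. by rewrite /Phi fineK// fin_num_measure. Qed.

Lemma Phi_le1 x : Phi x <= 1.
Proof. by rewrite -lee_fin -PhiE; exact: probability_le1. Qed.

Lemma Phi_nondecreasing x y : x <= y -> Phi x <= Phi y.
Proof.
move=> xy; rewrite -lee_fin -!PhiE le_measure ?inE//.
exact: subitvPr.
Qed.

(** The identity as a random variable under the normal law: its [cdf] is [Phi], so the limits of a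
    [cdf] at both infinities apply to [Phi]. *)
Let idR : measurableTypeR R -> R := idfun.

#[local] HB.instance Definition _ :=
  @isMeasurableFun.Build _ _ _ _ idR (@measurable_id _ _ setT).

Lemma Phi_tails (eta : R) : 0 < eta ->
  exists2 L : R, 0 < L & Phi (- L) <= eta /\ 1 - eta <= Phi L.
Proof.
move=> eta0.
pose X : {RV (normal_prob 0 1 : probability (measurableTypeR R) R) >-> R} :=
  idR.
have cE : fine \o cdf X = Phi by [].
have h1 : Phi x @[x --> +oo] --> (1 : R).
  by rewrite -cE; apply: fine_cvg; exact: (cvg_cdfy1 X).
have h0 : Phi x @[x --> -oo] --> (0 : R).
  by rewrite -cE; apply: fine_cvg; exact: (cvg_cdfNy0 X).
have [M1 [_ HM1]] : \forall t \near +oo, 1 - eta <= Phi t.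
  by apply: (cvgr_ge 1 h1); rewrite ltrBlDr ltrDl.
have [M0 [_ HM0]] : \forall t \near -oo, Phi t <= eta by exact: (cvgr_le 0 h0).
exists (`|M1| + `|M0| + 1); first by rewrite ltr_wpDl// addr_ge0.
split.
  apply: HM0; have := ler_norm (- M0); have := normr_ge0 M1; rewrite normrN; lra.
by apply: HM1; have := ler_norm M1; have := normr_ge0 M0; lra.
Qed.

(** With u = x^2 / 2, exp u >= (1 + u / 2)^2, a polynomial of degree 4 in x; 8 times it dominates
    |x|^k for k <= 3. Higher powers do not occur in the derivatives below. *)
Lemma phi_moment_bound : exists2 C : R, 0 <= C &
  forall x, forall k, (k <= 3)%N -> `|x| ^+ k * phi x <= C.
Proof.
have c0 : 0 <= normal_peak (1 : R) by exact: normal_peak_ge0.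
exists (8 * normal_peak 1); first by rewrite mulr_ge0.
move=> x k k3; rewrite phiE mulrCA [leRHS]mulrC ler_wpM2l//.
rewrite expRN ler_pdivrMr ?expR_gt0//.
set u := x ^+ 2 / 2; set y := `|x|.
have u0 : 0 <= u by rewrite divr_ge0// sqr_ge0.
have yu : y ^+ 2 = 2 * u by rewrite /y real_normK ?num_real// /u; field.
have y0 : 0 <= y by rewrite normr_ge0.
have e0 := expR_ge0 (u / 2).
have eE : expR u = expR (u / 2) ^+ 2 by rewrite expr2 -expRD; congr expR; field.
have e1 : 1 + u / 2 <= expR (u / 2) by exact: expR_ge1Dx.
have e2 : (1 + u / 2) ^+ 2 <= expR u by rewrite eE ler_sqr ?nnegrE//; lra.
apply: (@le_trans _ _ (8 * (1 + u / 2) ^+ 2)); last by rewrite ler_wpM2l.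
have -> : u = y ^+ 2 / 2 by rewrite yu; field.
have y2 : 0 <= y ^+ 2 by rewrite sqr_ge0.
have y4 : 0 <= (y ^+ 2) ^+ 2 by rewrite sqr_ge0.
have y1 : 0 <= (y - 1) ^+ 2 by rewrite sqr_ge0.
have y1y : 0 <= (y ^+ 2 - y) ^+ 2 by rewrite sqr_ge0.
by case: k k3 => [|[|[|[|//]]]] _; nra.
Qed.

(** * The Gaussian smoothing of a half-line and its derivatives *)

(** The probability that x + sqrt s N <= b, for N standard normal. *)
Definition heat b s x : R := Phi ((b - x) * (Num.sqrt s)^-1).

(** With z = (b - x) / sqrt s this is z phi(z) / s, the opposite of the second derivative of
    [heat b s]. *)
Definition hermite b s x : R :=
  (Num.sqrt s)^-1 ^+ 2 * ((b - x) * (Num.sqrt s)^-1 * phi ((b - x) * (Num.sqrt s)^-1)).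

Let is_derive_affine b w x : is_derive x (1 : R) (fun x => (b - x) * w) (- w).
Proof. by apply: is_derive_eq; rewrite /GRing.scale/=; ring. Qed.

Let is_derive_rsqrt s : 0 < s ->
  is_derive s (1 : R) (fun s => (Num.sqrt s)^-1) (- ((Num.sqrt s)^-1 ^+ 3 / 2)).
Proof.
move=> s0; have r0 : Num.sqrt s != 0 by rewrite gt_eqF// sqrtr_gt0.
have D := is_derive1_sqrt s0.
apply: (is_derive_eq (is_deriveV r0 D)).
by rewrite /GRing.scale/=; field.
Qed.

Lemma is_derive_heat_x b s x : is_derive x (1 : R) (heat b s)
  (- ((Num.sqrt s)^-1 * phi ((b - x) * (Num.sqrt s)^-1))).
Proof.
set w := (Num.sqrt s)^-1.
apply: (is_derive_eq (is_derive1_comp (is_derive_Phi _) (is_derive_affine b w x))).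
by rewrite mulrN mulrC.
Qed.

Lemma is_derive_heat_xx b s x : is_derive x (1 : R)
  (fun x => - ((Num.sqrt s)^-1 * phi ((b - x) * (Num.sqrt s)^-1))) (- hermite b s x).
Proof.
rewrite /hermite; set w := (Num.sqrt s)^-1.
have D := is_derive1_comp (is_derive_phi _) (is_derive_affine b w x).
by apply: is_derive_eq; rewrite /GRing.scale/=; ring.
Qed.

Lemma is_derive_hermite_x b s x : is_derive x (1 : R) (fun x => - hermite b s x)
  ((Num.sqrt s)^-1 ^+ 3 * ((1 - ((b - x) * (Num.sqrt s)^-1) ^+ 2) *
     phi ((b - x) * (Num.sqrt s)^-1))).
Proof.
rewrite /hermite; set w := (Num.sqrt s)^-1.
have D := is_derive1_comp (is_derive_phi _) (is_derive_affine b w x).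
have D' := is_derive_affine b w x.
by apply: is_derive_eq; rewrite /GRing.scale/=; ring.
Qed.

(* The heat equation, as [- hermite b s] is the second derivative of [heat b s]. *)
Lemma is_derive_heat_s b s x : 0 < s ->
  is_derive s (1 : R) (fun s => heat b s x) (- (hermite b s x / 2)).
Proof.
move=> s0; have D := is_derive_rsqrt s0.
have D' : is_derive s (1 : R) (fun s => (b - x) * (Num.sqrt s)^-1)
    ((b - x) * - ((Num.sqrt s)^-1 ^+ 3 / 2)).
  by apply: is_derive_eq; rewrite /GRing.scale/=; ring.
apply: (is_derive_eq (is_derive1_comp (is_derive_Phi _) D')).
by rewrite /hermite; ring.
Qed.

Lemma is_derive_hermite_s b s x : 0 < s ->
  is_derive s (1 : R) (fun s => hermite b s x)
  (- ((Num.sqrt s)^-1 ^+ 4 * ((3 - ((b - x) * (Num.sqrt s)^-1) ^+ 2) / 2 *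
     ((b - x) * (Num.sqrt s)^-1 * phi ((b - x) * (Num.sqrt s)^-1))))).
Proof.
move=> s0; have D := is_derive_rsqrt s0.
have D1 : is_derive s (1 : R) (fun s => (b - x) * (Num.sqrt s)^-1)
    ((b - x) * - ((Num.sqrt s)^-1 ^+ 3 / 2)).
  by apply: is_derive_eq; rewrite /GRing.scale/=; ring.
have D2 := is_derive1_comp (is_derive_phi _) D1.
by apply: is_derive_eq; rewrite /GRing.scale/=; field; rewrite gt_eqF// sqrtr_gt0.
Qed.

(** Each expression is a power of w <= 1 / sqrt e times a polynomial in z of degree at most 3 times
    phi z. The factor 2 bounds the sum of the absolute coefficients of 1 - z^2 and of (3 z - z^3) /
    2. *)
Lemma heat_derivatives_bound e : 0 < e -> exists2 M : R, 0 <= M &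
  forall b s x, e <= s -> let w := (Num.sqrt s)^-1 in let z := (b - x) * w in
  [/\ `|- (w * phi z)| <= M, `|hermite b s x| <= M,
      `|w ^+ 3 * ((1 - z ^+ 2) * phi z)| <= M &
      `|- (w ^+ 4 * ((3 - z ^+ 2) / 2 * (z * phi z)))| <= M].
Proof.
move=> e0; have [C C0 HC] := phi_moment_bound.
pose W : R := (Num.sqrt e)^-1.
have W0 : 0 <= W by rewrite invr_ge0.
exists (2 * C * (W + W ^+ 2 + W ^+ 3 + W ^+ 4)).
  by rewrite mulr_ge0 ?addr_ge0 ?exprn_ge0 ?mulr_ge0.
move=> b s x es w z.
have s0 : 0 < s by exact: lt_le_trans es.
have w0 : 0 <= w by rewrite invr_ge0.
have wW : w <= W by rewrite lef_pV2 ?posrE ?sqrtr_gt0// ler_wsqrtr.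
have wk k : w ^+ k <= W ^+ k by rewrite lerXn2r.
have wk0 k : 0 <= w ^+ k by rewrite exprn_ge0.
have f0 : 0 <= phi z by rewrite /phi normal_pdf_ge0.
have H k (k3 : (k <= 3)%N) := HC z k k3.
have Wk0 k : 0 <= C * W ^+ k by rewrite mulr_ge0// exprn_ge0.
have [W1 W2 W3 W4] := And4 (Wk0 1%N) (Wk0 2%N) (Wk0 3%N) (Wk0 4%N).
rewrite expr1 in W1.
have bnd k (t D : R) : `|t| <= D -> `|w ^+ k * t| <= D * W ^+ k.
  move=> tD; rewrite normrM (ger0_norm (wk0 k)) mulrC ler_pM//.
have m k (k3 : (k <= 3)%N) : `|z ^+ k * phi z| <= C.
  by rewrite normrM normrX (ger0_norm f0); exact: H.
split.
- rewrite normrN; apply: (le_trans (bnd 1%N (phi z) C _)); last first.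
    by rewrite expr1; nra.
  by have := m 0%N isT; rewrite expr0 mul1r.
- by apply: (le_trans (bnd 2%N (z * phi z) C (m 1%N isT))); nra.
- apply: (le_trans (bnd 3%N ((1 - z ^+ 2) * phi z) (2 * C) _)); last nra.
  have := m 0%N isT; have := m 2%N isT; rewrite expr0 mul1r !ler_norml => /andP[? ?] /andP[? ?].
  apply/andP; split; lra.
- rewrite normrN.
  apply: (le_trans (bnd 4%N ((3 - z ^+ 2) / 2 * (z * phi z)) (2 * C) _)); last nra.
  have := m 1%N isT; have := m 3%N isT; rewrite expr1 exprSr.
  rewrite !ler_norml => /andP[? ?] /andP[? ?].
  apply/andP; split; lra.
Qed.

Lemma heat_lipschitz e : 0 < e -> exists2 M : R, 0 <= M &
  forall b s s' x x', e <= s -> e <= s' ->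
  `|heat b s x - heat b s' x'| <= M * (`|s - s'| + `|x - x'|).
Proof.
move=> e0; have [M M0 HM] := heat_derivatives_bound e0.
exists M => // b s s' x x' es es'.
have Hx : `|heat b s x - heat b s x'| <= M * `|x - x'|.
  apply: le_normB_segment => t _; split; first exact: is_derive_heat_x.
  by have [] := HM b s t es.
have Hs : `|heat b s x' - heat b s' x'| <= M * `|s - s'|.
  apply: (@le_normB_segment _ (fun s => heat b s x')) => t /andP[t1 _].
  have et : e <= t by apply: le_trans t1; rewrite le_min es' es.
  split; first by apply: is_derive_heat_s; exact: lt_le_trans et.
  have [_ h _ _] := HM b t x' et; rewrite normrN.
  move: h; rewrite !ler_norml => /andP[h1 h2]; apply/andP; split; lra.
have := ler_distD (heat b s x') (heat b s x) (heat b s' x'); lra.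
Qed.

(** Expanding around the mean x + q y of a Bernoulli jump kills the first-order terms. The variance
    q (1 - q) y^2 is matched, through the heat equation, by a time increment q y^2; the mismatch
    gives the term q^2 y^2, and the third-order remainders give q y^3. *)
Lemma heat_bernoulli_step e : 0 < e -> exists2 M : R, 0 <= M &
  forall b s x y q, e <= s -> 0 <= y <= 1 -> 0 <= q <= 1 ->
  `|heat b (s + q * y ^+ 2) (x + q * y) - (1 - q) * heat b s x
      - q * heat b s (x + y)| <= M * (q * y ^+ 3 + q ^+ 2 * y ^+ 2).
Proof.
move=> e0; have [M M0 HM] := heat_derivatives_bound e0.
exists (4 * M); first by rewrite mulr_ge0.
move=> b s x y q es /andP[y0 y1] /andP[q0 q1].
set tau := q * y ^+ 2; set x0 := x + q * y.
have s0 : 0 < s by exact: lt_le_trans es.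
have tau0 : 0 <= tau by rewrite mulr_ge0// sqr_ge0.
have T u : `|heat b s (x0 + u) - heat b s x0 -
    u * - ((Num.sqrt s)^-1 * phi ((b - x0) * (Num.sqrt s)^-1)) -
    u ^+ 2 / 2 * - hermite b s x0| <= M * `|u| ^+ 3.
  apply: (@taylor2_bound _ (heat b s)
    (fun x => - ((Num.sqrt s)^-1 * phi ((b - x) * (Num.sqrt s)^-1)))
    (fun x => - hermite b s x)
    (fun x => (Num.sqrt s)^-1 ^+ 3 * ((1 - ((b - x) * (Num.sqrt s)^-1) ^+ 2) *
     phi ((b - x) * (Num.sqrt s)^-1)))) => t.
  - exact: is_derive_heat_x.
  - exact: is_derive_heat_xx.
  - exact: is_derive_hermite_x.
  - by have [] := HM b s t es.
set g1 := - ((Num.sqrt s)^-1 * _) in T.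
have [s' [ss' s't ds']] : exists s' : R, [/\ s <= s', s' <= s + tau &
    heat b (s + tau) x0 - heat b s x0 = - (hermite b s' x0 / 2) * tau].
  have [|||c] := @MVT_segment _ (fun s => heat b s x0)
     (fun s => - (hermite b s x0 / 2)) s (s + tau).
  - by rewrite lerDl.
  - move=> t; rewrite in_itv/= => /andP[st _]; apply: is_derive_heat_s.
    exact: lt_trans st.
  - apply: continuous_in_subspaceT => t /set_mem/=; rewrite in_itv/= => /andP[st _].
    apply: differentiable_continuous; apply/derivable1_diffP.
    by have [] := @is_derive_heat_s b t x0 (lt_le_trans s0 st).
  rewrite in_itv/= => /andP[c1 c2] ->; exists c; split => //.
  by congr (_ * _); ring.
have es' : e <= s' by exact: le_trans ss'.
have Hh : `|hermite b s' x0 - hermite b s x0| <= M * tau.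
  have := @le_normB_segment _ (fun s => hermite b s x0)
    (fun s => - ((Num.sqrt s)^-1 ^+ 4 * ((3 - ((b - x0) * (Num.sqrt s)^-1) ^+ 2) / 2 *
     ((b - x0) * (Num.sqrt s)^-1 * phi ((b - x0) * (Num.sqrt s)^-1))))) M s s'.
  move=> /(_ _)/le_trans; apply => [t /andP[t1 _]|].
    have et : e <= t by apply: le_trans t1; rewrite min_l.
    split; first by apply: is_derive_hermite_s; exact: lt_le_trans et.
    by have [] := HM b t x0 et.
  by rewrite ler_wpM2l// ger0_norm ?subr_ge0//; lra.
have [_ Hb _ _] := HM b s x0 es.
have T1 := T (- (q * y)); have T2 := T ((1 - q) * y).
have E1 : x0 + - (q * y) = x by rewrite /x0; ring.
have E2 : x0 + (1 - q) * y = x + y by rewrite /x0; ring.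
rewrite E1 normrN (ger0_norm (mulr_ge0 q0 y0)) in T1.
have q0' : 0 <= 1 - q by rewrite subr_ge0.
rewrite E2 (ger0_norm (mulr_ge0 q0' y0)) in T2.
have y3 : 0 <= y ^+ 3 by rewrite exprn_ge0.
have q3 : q ^+ 3 <= q by rewrite exprS ler_piMr// exprn_ile1.
have q3' : (1 - q) ^+ 3 <= 1 by rewrite exprn_ile1// gerBl.
have T1' : `|(1 - q) * (heat b s x - heat b s x0 - - (q * y) * g1 -
    (- (q * y)) ^+ 2 / 2 * - hermite b s x0)| <= M * (q * y ^+ 3).
  rewrite normrM (ger0_norm q0'); apply: (le_trans (ler_wpM2l q0' T1)).
  rewrite exprMn mulrCA ler_wpM2l// mulrA ler_wpM2r//; nra.
have T2' : `|q * (heat b s (x + y) - heat b s x0 - (1 - q) * y * g1 -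
    ((1 - q) * y) ^+ 2 / 2 * - hermite b s x0)| <= M * (q * y ^+ 3).
  rewrite normrM (ger0_norm q0); apply: (le_trans (ler_wpM2l q0 T2)).
  rewrite exprMn mulrCA ler_wpM2l// mulrA ler_wpM2r//; nra.
have T3' : `|tau * (hermite b s' x0 - hermite b s x0)| <= M * (q ^+ 2 * y ^+ 2).
  rewrite normrM (ger0_norm tau0); apply: (le_trans (ler_wpM2l tau0 Hh)).
  rewrite mulrCA ler_wpM2l// /tau.
  have : y ^+ 2 <= 1 by rewrite expr_le1.
  have : 0 <= q ^+ 2 * y ^+ 2 by rewrite mulr_ge0 ?sqr_ge0.
  nra.
have T4' : `|tau * q * hermite b s x0| <= M * (q ^+ 2 * y ^+ 2).
  rewrite normrM (ger0_norm (mulr_ge0 tau0 q0)) mulrC (_ : tau * q = q ^+ 2 * y ^+ 2).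
    by rewrite ler_wpM2r// mulr_ge0 ?sqr_ge0.
  by rewrite /tau; ring.
(* Exact decomposition into the time remainder, the variance mismatch and the two Taylor remainders;
   the [g1] terms cancel. *)
rewrite (_ : _ - q * _ = - (tau * (hermite b s' x0 - hermite b s x0)) / 2 -
    tau * q * hermite b s x0 / 2 -
    (1 - q) * (heat b s x - heat b s x0 - - (q * y) * g1 -
      (- (q * y)) ^+ 2 / 2 * - hermite b s x0) -
    q * (heat b s (x + y) - heat b s x0 - (1 - q) * y * g1 -
      ((1 - q) * y) ^+ 2 / 2 * - hermite b s x0)); last first.
  have -> : heat b (s + tau) x0 = heat b s x0 + - (hermite b s' x0 / 2) * tau.
    by rewrite -ds'; ring.
  by rewrite /tau; field.
move: T1' T2' T3' T4'; rewrite !ler_norml.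
move=> /andP[? ?] /andP[? ?] /andP[? ?] /andP[? ?].
have y3q : 0 <= M * (q * y ^+ 3) by rewrite !mulr_ge0.
have y2q : 0 <= M * (q ^+ 2 * y ^+ 2) by rewrite !mulr_ge0 ?sqr_ge0.
by apply/andP; split; lra.
Qed.

End normal_cdf.

(** * Real-valued probabilities of events *)

Section pr.
Context {d : measure_display} {T : measurableType d} {R : realType}.
Variable P : probability T R.
Implicit Types (A B : set T) (X : nat -> {RV P >-> bool}).

Definition pr A : R := fine (P A).

Lemma pr_ge0 A : 0 <= pr A.
Proof. exact: fine_ge0. Qed.

Lemma EFin_pr A : measurable A -> (pr A)%:E = P A.
Proof. by move=> mA; rewrite fineK// fin_num_measure. Qed.

Lemma pr_setU A B : measurable A -> measurable B -> A `&` B = set0 ->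
  pr (A `|` B) = pr A + pr B.
Proof. by move=> mA mB AB; rewrite /pr measureU// fineD ?fin_num_measure. Qed.

Lemma pr_setT : pr setT = 1.
Proof. by rewrite /pr probability_setT. Qed.

Lemma pr_setC A : measurable A -> pr (~` A) = 1 - pr A.
Proof.
move=> mA; rewrite -pr_setT -(setvU A) pr_setU ?setICl//; last exact: measurableC.
by rewrite addrK.
Qed.

Lemma pr_ae_eq A B : measurable A -> measurable B ->
  {ae P, forall t, A t <-> B t} -> pr A = pr B.
Proof.
move=> mA mB [N [mN PN sN]]; congr fine.
have le C D : measurable C -> measurable D ->
    (forall t, C t -> ~ D t -> N t) -> (P C <= P D)%E.
  move=> mC mD H; apply: (@le_trans _ _ (P (D `|` N))).
    rewrite le_measure ?inE//; first exact: measurableU.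
    by move=> t Ct; have [Dt|nDt] := pselect (D t); [left|right; exact: H].
  rewrite (le_trans (measureU2 _ _ _))//.
  by rewrite [X in (_ + X <= _)%E](_ : _ = 0%E) ?adde0.
apply/eqP; rewrite eq_le; apply/andP; split; apply: le => // t ? ?; apply: sN => -[].
  by move=> /(_ ltac:(assumption)).
by move=> _ /(_ ltac:(assumption)).
Qed.

Lemma measurable_ev X i b : measurable (ev X i b).
Proof.
rewrite -[ev _ _ _]setTI (_ : ev X i b = X i @^-1` [set b])//.
exact: (measurable_funP (X i)).
Qed.

Lemma pr_split X i A : measurable A ->
  pr A = pr (A `&` ev X i false) + pr (A `&` ev X i true).
Proof.
move=> mA; rewrite -pr_setU.
- congr pr; apply/seteqP; split=> [t At|t [[]|[]]//].
  by case E : (X i t); [right|left].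
- by apply: measurableI => //; exact: measurable_ev.
- by apply: measurableI => //; exact: measurable_ev.
- by apply/seteqP; split=> // t [[_ /= e] [_]]; rewrite /ev/= e.
Qed.

Lemma pr_sum_values (F : T -> nat) N A : measurable A ->
  (forall k, measurable [set t | F t = k]) -> (forall t, F t < N)%N ->
  \sum_(k < N) pr (A `&` [set t | F t = k]) = pr A.
Proof.
move=> mA mF FN.
have mL j : measurable [set t | (F t < j)%N].
  rewrite (_ : [set _ | _] = \bigcup_(k in `I_j) [set t | F t = k]).
    by apply: bigcup_measurable.
  by apply/seteqP; split=> [t/= h|t [k/= kj ->]//]; exists (F t).
have H j : \sum_(k < j) pr (A `&` [set t | F t = k]) = pr (A `&` [set t | (F t < j)%N]).
  elim: j => [|j IH].
    rewrite big_ord0 (_ : _ `&` _ = set0) ?/pr ?measure0//.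
    by apply/seteqP; split=> // t [].
  rewrite big_ord_recr/= IH -pr_setU.
  - congr pr; rewrite -setIUr; congr (_ `&` _); apply/seteqP; split=> t/=.
      by move=> [/ltnW//|->].
    by rewrite ltnS leq_eqVlt => /orP[/eqP|]; [right|left].
  - exact: measurableI.
  - exact: measurableI.
  - by apply/seteqP; split=> // t [[_ /= Fj] [_ /= Ft]]; move: Fj; rewrite Ft ltnn.
rewrite H; congr pr; apply/seteqP; split=> [t []//|t At]; split=> //.
exact: FN.
Qed.

(** * The Markov property for events of the past *)

Section history.
Variables (n : nat) (p : nat -> R) (X : nat -> {RV P >-> bool}).
Hypothesis HX : derangement_process n p X.

Lemma history_sub_ev r x : (r <= n)%N -> history X n r x `<=` ev X r.+1 (x r.+1).
Proof. by move=> rn t; apply; rewrite leqnn ltnS. Qed.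

(** Splitting on one more coordinate refines a history; inductions over histories proceed by this
    step. *)
Lemma history_succ r x b : (r <= n)%N ->
  history X n r.+1 x `&` ev X r.+1 b =
  history X n r (fun j => if j == r.+1 then b else x j).
Proof.
move=> rn; apply/seteqP; split=> [t [h /= Xb] j /andP[rj jn]|t h].
  case: eqP => [->//|/eqP jr].
  by apply: h; rewrite jn ltn_neqAle eq_sym jr rj.
split=> [j /andP[rj jn]|].
  by rewrite (h j) ?(ltnW rj) ?jn//= gtn_eqF.
by rewrite /ev/= (h r.+1) ?leqnn ?ltnS ?rn//= eqxx.
Qed.

Lemma history_last x : history X n n.+1 x = setT.
Proof.
by apply/seteqP; split=> // t _ j /andP[h1 h2]; have := leq_trans h1 h2; rewrite ltnn.
Qed.

Lemma measurable_history r x : measurable (history X n r x).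
Proof.
have [rn|rn] := leqP r n.+1; last first.
  rewrite (_ : history _ _ _ _ = setT)//.
  apply/seteqP; split=> // t _ j /andP[h1 h2].
  by have := leq_trans rn (ltnW (leq_trans h1 h2)); rewrite ltnn.
(* Induction on the number n + 1 - r of constrained coordinates; beyond n the truncated subtraction
   stays at 0. *)
rewrite -(subKn rn); elim: (n.+1 - r)%N x => [|m IH] x.
  by rewrite subn0 history_last.
have [mn|mn] := leqP n.+1 m.
  by have := IH x; have -> : (n.+1 - m.+1 = n.+1 - m)%N by lia.
have -> : history X n (n.+1 - m.+1) x =
    history X n (n.+1 - m) x `&` ev X (n.+1 - m) (x (n.+1 - m)%N).
  have -> : (n.+1 - m = (n.+1 - m.+1).+1)%N by rewrite -subSn.
  rewrite history_succ; last by rewrite subSS leq_subr.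
  by congr history; apply/funext => j; case: eqP => [->|].
by apply: measurableI => //; exact: measurable_ev.
Qed.

Lemma pr_history_step r x b (kappa : R) : (1 <= r <= n)%N ->
  (P (ev X r.+1 (x r.+1)) != 0%E ->
     cond_prob P (ev X r b) (ev X r.+1 (x r.+1)) = kappa) ->
  pr (history X n r x `&` ev X r b) = kappa * pr (history X n r x).
Proof.
move=> /andP[r1 rn] Hk.
have mH := measurable_history r x; have mE := measurable_ev X r b.
have [H0|H0] := eqVneq (P (history X n r x)) 0%E.
  rewrite /pr H0/= mulr0 (_ : P _ = 0%E)//.
  apply/eqP; rewrite eq_le measure_ge0 -H0 andbT le_measure ?inE//.
  exact: measurableI.
have E0 : P (ev X r.+1 (x r.+1)) != 0%E.
  apply: contra H0 => /eqP E0; rewrite eq_le measure_ge0 andbT -E0.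
  by rewrite le_measure ?inE//; [exact: measurable_ev|exact: history_sub_ev].
(* The Markov hypothesis reads the value at r from the path itself. Setting it to b does not change
   the history, which only constrains indices above r. *)
pose x' j := if j == r then b else x j.
have Hx' : history X n r x' = history X n r x.
  apply/seteqP; split=> t h j /[dup] /andP[rj _] /h; rewrite /x' gtn_eqF//.
have := @dp_markov _ _ _ _ _ _ _ HX r x'; rewrite r1 rn Hx' => /(_ isT H0).
rewrite /x' eqxx gtn_eqF// Hk// /cond_prob setIC => <-.
rewrite divfK// -/(pr _).
apply: contra H0 => /eqP h; by rewrite -(EFin_pr mH) h.
Qed.

(** Extends the one-step rule from a single history to any event A that is a union of histories, by
    summing over all paths. *)
Lemma pr_markov r A c b (kappa : R) : (1 <= r <= n)%N -> measurable A ->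
  (forall x, history X n r x `<=` A \/ history X n r x `&` A = set0) ->
  (P (ev X r.+1 c) != 0%E -> cond_prob P (ev X r b) (ev X r.+1 c) = kappa) ->
  pr (A `&` ev X r.+1 c `&` ev X r b) = kappa * pr (A `&` ev X r.+1 c).
Proof.
move=> rn mA HA Hk.
set B := A `&` ev X r.+1 c.
have mB : measurable B by apply: measurableI => //; exact: measurable_ev.
(* Induction from complete to no information: for m = 0 the whole path above r is fixed, each step
   forgets one more coordinate by summing over its two values, and m = n + 1 - r leaves no
   constraint, so any path will do there. *)
suff H m x : (r + m <= n.+1)%N ->
    pr (B `&` history X n (r + m) x `&` ev X r b) =
    kappa * pr (B `&` history X n (r + m) x).
  have := H (n.+1 - r)%N (fun=> false).
  have /andP[_ rn'] := rn; rewrite subnKC ?(leqW rn')// => /(_ (leqnn _)).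
  by rewrite history_last !setIT.
elim: m x => [|m IH] x.
  rewrite addn0 => _.
  have B0 : B `&` history X n r x = set0 ->
      pr (B `&` history X n r x `&` ev X r b) = kappa * pr (B `&` history X n r x).
    by move=> ->; rewrite set0I /pr measure0/= mulr0.
  have rn' : (r <= n)%N by case/andP: rn.
  have [xc|xc] := eqVneq (x r.+1) c; last first.
    apply: B0; apply/seteqP; split=> // t [[_ /= Xc] /(history_sub_ev rn')/= Xx].
    by move: xc; rewrite -Xx Xc eqxx.
  have [HxA|HxA] := HA x; last first.
    by apply: B0; apply/seteqP; split=> // t [[At _] Ht]; rewrite -HxA.
  rewrite (_ : B `&` _ = history X n r x); last first.
    apply: setIidr => t Ht; split; first exact: HxA.
    by rewrite -xc; exact: history_sub_ev Ht.
  by apply: pr_history_step => //; rewrite xc.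
rewrite addnS => rm.
have mH := measurable_history (r + m).+1 x.
rewrite (@pr_split X (r + m).+1); last first.
  by apply: measurableI; [exact: measurableI|exact: measurable_ev].
rewrite [in RHS](@pr_split X (r + m).+1); last exact: measurableI.
rewrite ![_ `&` ev X r b `&` _]setIAC -![B `&` history _ _ _ _ `&` _]setIA.
by rewrite !history_succ// !IH ?(ltnW rm)// mulrDr.
Qed.

(** * The joint law of the running cycle count and the current state *)

(** The cycles already counted once the descending chain has reached r + 1; the start X_{n+1} = 1 is
    left out. *)
Definition tailsum r t : nat := (\sum_(r.+1 <= i < n.+1) X i t)%N.

Lemma tailsumS r t : (r < n)%N -> tailsum r t = (X r.+1 t + tailsum r.+1 t)%N.
Proof. by move=> rn; rewrite /tailsum big_ltn. Qed.

Lemma tailsum_le r t : (tailsum r t <= n - r)%N.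
Proof.
rewrite /tailsum; apply: (@leq_trans (\sum_(r.+1 <= i < n.+1) 1)%N).
  by apply: leq_sum => i _; exact: leq_b1.
by rewrite sum_nat_const_nat muln1 subSS.
Qed.

Lemma measurable_tailsum r k : measurable [set t | tailsum r t = k].
Proof.
have mf : measurable_fun setT (fun t => \sum_(r.+1 <= i < n.+1) (X i t)%:R : R).
  apply: (@measurable_sum _ _ _ _ _ _ (fun i t => (X i t)%:R)) => i.
  exact: (@measurableT_comp _ _ _ _ _ _ (fun b : bool => b%:R : R)).
have := mf measurableT [set k%:R] (measurable_set1 _); rewrite setTI.
congr measurable; apply/seteqP; split=> t /=; rewrite -natr_sum.
  by move=> /eqP; rewrite eqr_nat => /eqP.
by rewrite -/(tailsum r t) => ->.
Qed.

Lemma history_tailsum r k x :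
  history X n r x `<=` [set t | tailsum r t = k] \/
  history X n r x `&` [set t | tailsum r t = k] = set0.
Proof.
have H t : history X n r x t -> tailsum r t = (\sum_(r.+1 <= i < n.+1) x i)%N.
  move=> Ht; apply: eq_big_nat => i /andP[ri iN].
  by rewrite Ht// ri ltnW.
have [xk|xk] := eqVneq (\sum_(r.+1 <= i < n.+1) x i)%N k.
  by left=> t /H/= ->.
by right; apply/seteqP; split=> // t [/H + /= tk]; rewrite tk => /esym/eqP; rewrite (negbTE xk).
Qed.

Definition mass r k b := pr ([set t | tailsum r t = k] `&` ev X r.+1 b).

Lemma mass_ge0 r k b : 0 <= mass r k b.
Proof. exact: pr_ge0. Qed.

Lemma mass_eq0 r k b : (n - r < k)%N -> mass r k b = 0.
Proof.
move=> rk; rewrite /mass (_ : _ `&` _ = set0) ?/pr ?measure0//.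
apply/seteqP; split=> // t [/= tk _].
by move: rk; rewrite -tk ltnNge tailsum_le.
Qed.

Lemma mass_sum r : (1 <= r)%N -> (1 <= n)%N ->
  \sum_(k < n) (mass r k false + mass r k true) = 1.
Proof.
move=> r1 n1; rewrite -pr_setT -(@pr_sum_values (tailsum r) n setT)//.
- by apply: eq_bigr => k _; rewrite setTI -pr_split//; exact: measurable_tailsum.
- exact: measurable_tailsum.
- by move=> t; rewrite (leq_ltn_trans (tailsum_le r t))// ltn_subrL r1.
Qed.

(** Forward equation: state 0 at r + 1 comes from state 0 at r + 2 with probability p_{r+1}, or from
    state 1 with certainty, and leaves the count unchanged. *)
Lemma mass_false r k : (1 <= r)%N -> (r.+1 < n)%N ->
  mass r k false = p r.+1 * mass r.+1 k false + mass r.+1 k true.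
Proof.
move=> r1 rn.
have n1 : (r.+1 <= n.-1)%N by rewrite -ltnS prednK// (leq_trans _ rn).
have rn1 : (2 <= r.+1 <= n.-1)%N by rewrite ltnS r1.
have rn2 : (1 <= r.+1 <= n)%N := ltnW rn.
have mS := measurable_tailsum r.+1 k.
have := pr_markov rn2 mS (history_tailsum _ _) (dp_00 HX rn1).
have := pr_markov rn2 mS (history_tailsum _ _) (dp_10 HX rn1).
rewrite mul1r /mass => <- <-.
rewrite [LHS](@pr_split X r.+2); last first.
  by apply: measurableI; [exact: measurable_tailsum|exact: measurable_ev].
have E : [set t | tailsum r t = k] `&` ev X r.+1 false =
    [set t | tailsum r.+1 t = k] `&` ev X r.+1 false.
  by apply/seteqP; split=> t [/= tk Xt]; split=> //=; move: tk;
     rewrite (tailsumS t (ltnW rn)) Xt.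
by rewrite E [in X in X + _ = _]setIAC [in X in _ + X = _]setIAC.
Qed.

(** Conservation of probability: the event that the count above r + 1 is k splits according to
    X_{r+1} and also according to X_{r+2}. Subtracting [mass_false] leaves the factor q_{r+1}. *)
Lemma mass_true r k : (1 <= r)%N -> (r.+1 < n)%N ->
  mass r k.+1 true = qcoef p r.+1 * mass r.+1 k false.
Proof.
move=> r1 rn; have mS := measurable_tailsum r.+1 k.
have := mass_false k r1 rn.
have E (b : bool) : [set t | tailsum r t = (b + k)%N] `&` ev X r.+1 b =
    [set t | tailsum r.+1 t = k] `&` ev X r.+1 b.
  apply/seteqP; split=> t [/= tk Xt]; split=> //=; move: tk;
     rewrite (tailsumS t (ltnW rn)) Xt; [exact: addnI|by move=> ->].
rewrite {1 4}/mass -[k.+1]add1n -[k in LHS]add0n (E true) (E false).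
have := pr_split X r.+1 mS; have := pr_split X r.+2 mS; rewrite -!/(mass _ _ _) => -> e1 e2.
rewrite /qcoef; move: e1 e2; set u := pr _; set v := pr _; set M1 := mass _ _ _; set M2 := mass _ _ _; lra.
Qed.

Lemma mass_true0 r : (r < n)%N -> mass r 0 true = 0.
Proof.
move=> rn; rewrite /mass (_ : _ `&` _ = set0) ?/pr ?measure0//.
by apply/seteqP; split=> // t [/= + Xt]; rewrite tailsumS// Xt.
Qed.

(** Initial condition of the forward equations, as X_n = 0 almost surely. *)
Lemma mass_last k b : (1 <= n)%N ->
  mass n.-1 k b = ((k == 0%N) && (b == false))%:R.
Proof.
move=> n1; rewrite /mass.
have mS : measurable ([set t | tailsum n.-1 t = k] `&` ev X n.-1.+1 b).
  by apply: measurableI; [exact: measurable_tailsum|exact: measurable_ev].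
have E t : X n t = false ->
   ([set t | tailsum n.-1 t = k] `&` ev X n.-1.+1 b) t <-> (k == 0%N) && (b == false).
  rewrite /ev/= /tailsum prednK// big_nat1 => ->; split=> [[<- <-]//|].
  by move=> /andP[/eqP-> /eqP->].
have [kb|kb] := boolP ((k == 0%N) && (b == false)).
  rewrite -pr_setT; apply: pr_ae_eq => //.
  by apply: filterS (dp_first HX) => t /E ->.
rewrite -[RHS](_ : pr set0 = _); last by rewrite /pr measure0.
apply: pr_ae_eq => //.
by apply: filterS (dp_first HX) => t /E ->; rewrite (negbTE kb).
Qed.

(** The shift [k.+1] accounts for X_1 = 1. *)
Lemma pr_cycles (B : pred nat) : (2 <= n)%N ->
  pr [set t | B (\sum_(1 <= i < n.+1) X i t)%N] =
  \sum_(k < n) (B k.+1)%:R * (mass 1 k false + mass 1 k true).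
Proof.
move=> n2; have n1 := ltnW n2.
have mB : measurable [set t | B (tailsum 1 t).+1].
  rewrite (_ : [set _ | _] = \bigcup_(k in [set k | B k.+1]) [set t | tailsum 1 t = k]).
    by apply: bigcup_measurable => k _; exact: measurable_tailsum.
  by apply/seteqP; split=> [t/= h|t [k/= kB ->]//]; exists (tailsum 1 t).
have mB' : measurable [set t | B (\sum_(1 <= i < n.+1) X i t)%N].
  rewrite (_ : [set _ | _] = \bigcup_(k in [set k | B k]) [set t | tailsum 0 t = k]).
    by apply: bigcup_measurable => k _; exact: measurable_tailsum.
  by apply/seteqP; split=> [t/= h|t [k/= kB]]; [exists (tailsum 0 t)|rewrite /tailsum => ->].
rewrite (@pr_ae_eq _ [set t | B (tailsum 1 t).+1])//; last first.
  apply: filterS (dp_last HX) => t X1.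
  by rewrite /= -/(tailsum 0 t) tailsumS// X1.
rewrite -(@pr_sum_values (tailsum 1) n)//.
- apply: eq_bigr => k _.
  rewrite /mass -pr_split; last exact: measurable_tailsum.
  have [Bk|Bk] := boolP (B k.+1).
    rewrite mul1r; congr pr; apply/seteqP; split=> [t []//|t /= ->]//.
  rewrite mul0r -[RHS](_ : pr set0 = _); last by rewrite /pr measure0.
  by congr pr; apply/seteqP; split=> // t [/= + tk]; rewrite tk (negbTE Bk).
- by move=> k; exact: measurable_tailsum.
- by move=> t; rewrite (leq_ltn_trans (tailsum_le 1 t))// ltn_subrL.
Qed.

(** * Comparison with an approximate solution of the backward recursion *)

Section recursion.
Variables (V : nat -> nat -> R) (e : nat -> R).
Hypothesis HV : forall r k, (2 <= r < n)%N ->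
  `|V r k - p r * V r.-1 k - qcoef p r * V r.-2 k.+1| <= e r.

(** The mean of V along the chain. After state 1 the next state 0 is forced, so that one index is
    skipped and [V r.-1] replaces [V r]. *)
Let E r := \sum_(k < n) (V r k * mass r k false + V r.-1 k * mass r k true).

(** After inserting the forward equations, the terms with [mass r.+1 k true] cancel and the
    coefficient of [mass r.+1 k false] is the defect of V in the recursion. The total mass is 1. *)
Let E_step r : (1 <= r)%N -> (r.+1 < n)%N -> `|E r.+1 - E r| <= e r.+1.
Proof.
move=> r1 rn; have n1 : (1 <= n)%N by exact: leq_trans rn.
have -> : E r = \sum_(k < n) (V r k * (p r.+1 * mass r.+1 k false + mass r.+1 k true)
    + V r.-1 k.+1 * (qcoef p r.+1 * mass r.+1 k false)).
  rewrite /E !big_split/=; congr (_ + _).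
    by apply: eq_bigr => k _; rewrite mass_false.
  have [N nN] : exists N, n = N.+1 by exists n.-1; rewrite prednK.
  (* The index shift in k loses nothing: the first term vanishes because state 1 has already been
     counted, the last one because the count is at most n - r - 1. *)
  rewrite [in LHS]nN [in RHS]nN big_ord_recl big_ord_recr/=.
  rewrite mass_true0 ?(ltnW rn)// mulr0 add0r.
  rewrite [mass r.+1 N false]mass_eq0 ?mulr0 ?addr0; last by rewrite nN subSS; lia.
  by apply: eq_bigr => k _; rewrite mass_true.
rewrite /E -sumrB.
have e0 : 0 <= e r.+1 by apply: le_trans (HV 0 _); rewrite // ltnS r1.
apply: (@le_trans _ _ (\sum_(k < n) e r.+1 * (mass r.+1 k false + mass r.+1 k true))).
  apply: (le_trans (ler_norm_sum _ _ _)); apply: ler_sum => k _.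
  have -> : V r.+1 k * mass r.+1 k false + V r.+1.-1 k * mass r.+1 k true -
      (V r k * (p r.+1 * mass r.+1 k false + mass r.+1 k true) +
       V r.-1 k.+1 * (qcoef p r.+1 * mass r.+1 k false)) =
      (V r.+1 k - p r.+1 * V r.+1.-1 k - qcoef p r.+1 * V r.+1.-2 k.+1) *
      mass r.+1 k false by rewrite /=; ring.
  rewrite normrM (ger0_norm (mass_ge0 _ _ _)).
  rewrite mulrDr ler_wpDr ?mulr_ge0 ?mass_ge0// ler_wpM2r ?mass_ge0//.
  by apply: HV; rewrite ltnS r1.
by rewrite -mulr_sumr mass_sum// mulr1.
Qed.

Let E_last : (2 <= n)%N -> E n.-1 = V n.-1 0.
Proof.
move=> n2; have n1 := ltnW n2.
rewrite /E -(big_mkord xpredT (fun k => V n.-1 k * mass n.-1 k false +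
  V n.-2 k * mass n.-1 k true)) big_ltn// big_nat_cond big1 => [|k].
  by rewrite !mass_last//= mulr1 mulr0 !addr0.
by rewrite !mass_last// andbT => /andP[/lt0n_neq0/negPf-> _]; rewrite !mulr0 addr0.
Qed.

(** Telescoping from r = n - 1, where E is the deterministic value V (n-1) 0, down to r = 1, where E
    + delta dominates the probability. Lower bounds will come from applying this to the complement
    of B. *)
Lemma pr_cycles_le (B : pred nat) (delta : R) : (2 <= n)%N ->
  (forall k, (B k.+1)%:R <= V 1 k + delta /\ (B k.+1)%:R <= V 0 k + delta) ->
  pr [set t | B (\sum_(1 <= i < n.+1) X i t)%N] <=
  V n.-1 0 + delta + \sum_(2 <= r < n) e r.
Proof.
move=> n2 HB.
have E1 j : (1 <= j)%N -> (j < n)%N -> `|E 1 - E j| <= \sum_(2 <= r < j.+1) e r.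
  elim: j => // -[|j] IH _ jn; first by rewrite subrr normr0 big_geq.
  rewrite big_nat_recr//=; apply: le_trans (ler_distD (E j.+1) _ _) _.
  by rewrite lerD// ?IH ?(ltnW jn)// distrC E_step.
have := E1 n.-1; rewrite prednK ?(ltnW n2)// -ltnS prednK ?(ltnW n2)//.
move=> /(_ n2 (leqnn _)); rewrite E_last// => /(le_trans (ler_norm _)) H.
rewrite pr_cycles//; apply: (@le_trans _ _ (E 1 + delta)); last by lra.
have -> : E 1 + delta = \sum_(k < n) ((V 1 k + delta) * mass 1 k false +
    (V 0 k + delta) * mass 1 k true).
  rewrite -[delta in LHS]mulr1 -(@mass_sum 1) ?(ltnW n2)// mulr_sumr /E -big_split/=.
  by apply: eq_bigr => k _; ring.
apply: ler_sum => k _; have [h1 h2] := HB k.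
by rewrite mulrDr lerD// ler_wpM2r ?mass_ge0.
Qed.

End recursion.

End history.
End pr.

(** * Partial sums of the q_i and normal approximation at a fixed scale *)

Section parameters.
Context {R : realType}.
Variable p : nat -> R.

Lemma qbarS n : qbar p n.+1 = qbar p n + qcoef p n.+1.
Proof. by rewrite /qbar big_nat_recr. Qed.

Lemma qbar0 : qbar p 0 = 0.
Proof. by rewrite /qbar big_geq. Qed.

Hypothesis hp1 : p 1%N = 0.
Hypothesis hp2 : p 2%N = 1.
Hypothesis hp : forall i, (3 <= i)%N -> 0 < p i < 1.

Lemma qcoef_itv i : (1 <= i)%N -> 0 <= qcoef p i <= 1.
Proof.
case: i => [//|[|[|i]]] _; rewrite /qcoef ?hp1 ?hp2 ?subr0 ?subrr ?ler01 ?lexx//.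
by have /andP[? ?] := hp (isT : (2 < i.+3)%N); apply/andP; split; lra.
Qed.

Lemma qbar_ge0 n : 0 <= qbar p n.
Proof.
rewrite /qbar big_nat sumr_ge0// => i /andP[i1 _].
by have /andP[] := qcoef_itv i1.
Qed.

Section normal_approximation.
Variables (e M D : R).
Hypothesis M0 : 0 <= M.
Hypothesis HL : forall b s s' x x', e <= s -> e <= s' ->
  `|heat b s x - heat b s' x'| <= M * (`|s - s'| + `|x - x'|).
Hypothesis HS : forall b s x y q, e <= s -> 0 <= y <= 1 -> 0 <= q <= 1 ->
  `|heat b (s + q * y ^+ 2) (x + q * y) - (1 - q) * heat b s x
      - q * heat b s (x + y)| <= M * (q * y ^+ 3 + q ^+ 2 * y ^+ 2).
Hypothesis HD : forall n,
  \sum_(2 <= r < n) qcoef p r * (qcoef p r + qcoef p r.-1) <= D.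

(* The scale [s] enters through [y = 1 / s]. *)
Definition clt_error (n : nat) (a y : R) := M * (`|qbar p n.-1 * y ^+ 2 - 1| +
  `|(qbar p n.-1 - a) * y| + (2 + 2 * D) * y + qbar p n.-1 * y ^+ 3).

(** The pair c0 = 0, c1 = 1 serves for upper bounds on B; c0 = 1, c1 = -1 serves for its
    complement. *)
Lemma pr_cycles_le_heat {d : measure_display} {T : measurableType d}
    (P : probability T R) (n : nat) (X : nat -> {RV P >-> bool}) (B : pred nat)
    (a y b c0 c1 eta : R) :
  (2 <= n)%N -> derangement_process n p X -> 0 <= y <= 1 -> `|c1| = 1 ->
  (forall k, (B k)%:R <= c0 + c1 * heat b e ((k%:R - a) * y) + eta) ->
  pr P [set t | B (\sum_(1 <= i < n.+1) X i t)%N] <=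
    c0 + c1 * heat b (e + 1) 0 + eta + clt_error n a y.
Proof.
move=> n2 HX y01 c11 HB; have /andP[y0 y1] := y01.
have y2 : 0 <= y ^+ 2 by rewrite sqr_ge0.
have y2y : y ^+ 2 <= y by rewrite expr2 ler_piMr.
have y3 : 0 <= y ^+ 3 by rewrite exprn_ge0.
pose V r k := c0 + c1 * heat b (e + qbar p r * y ^+ 2) ((k%:R + qbar p r - a) * y).
(* The first term comes from the Bernoulli step. The second absorbs its q_r^2 y^2 and the cost q_r
   q_{r-1} (y^2 + y) of replacing [V r.-2] by the value at r - 1 after a state 1; y <= 1 is used. *)
pose err r := M * (qcoef p r * y ^+ 3 + 2 * (qcoef p r * (qcoef p r + qcoef p r.-1)) * y).
have eV r : e <= e + qbar p r * y ^+ 2 by rewrite lerDl mulr_ge0 ?qbar_ge0.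
have HL1 s s' x x' : e <= s -> e <= s' ->
    `|c1 * heat b s x - c1 * heat b s' x'| <= M * (`|s - s'| + `|x - x'|).
  by move=> ? ?; rewrite -mulrBr normrM c11 mul1r; exact: HL.
have HV r k : (2 <= r < n)%N ->
    `|V r k - p r * V r.-1 k - qcoef p r * V r.-2 k.+1| <= err r.
  case: r => [|[|r]]//= _; rewrite /V /err/=.
  have q01 := @qcoef_itv r.+2 isT; have q01' := @qcoef_itv r.+1 isT.
  have -> : p r.+2 = 1 - qcoef p r.+2 by rewrite /qcoef; ring.
  rewrite (qbarS r.+1).
  have H1 := HS b ((k%:R + qbar p r.+1 - a) * y) (eV r.+1) y01 q01.
  have H2 := HL b ((k.+1%:R + qbar p r - a) * y) ((k%:R + qbar p r.+1 - a) * y + y) (eV r) (eV r.+1).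
  move: H1 H2; rewrite qbarS.
  set q := qcoef p r.+2; set q' := qcoef p r.+1; set m := qbar p r.
  have -> : e + (m + q' + q) * y ^+ 2 = e + (m + q') * y ^+ 2 + q * y ^+ 2 by ring.
  have -> : (k%:R + (m + q' + q) - a) * y = (k%:R + (m + q') - a) * y + q * y by ring.
  set h1 := heat _ _ _; set h2 := heat _ _ _; set h3 := heat _ _ _; set h4 := heat _ _ _.
  have -> : e + m * y ^+ 2 - (e + (m + q') * y ^+ 2) = - (q' * y ^+ 2) by ring.
  have -> : (k.+1%:R + m - a) * y - ((k%:R + (m + q') - a) * y + y) = - (q' * y).
    by rewrite -natr1; ring.
  have /andP[q0 q1] : 0 <= q <= 1 by [].
  have /andP[q0' q1'] : 0 <= q' <= 1 by [].
  rewrite !normrN !(ger0_norm (mulr_ge0 q0' _))// => H1 H2.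
  have H3 : `|c1 * (h1 - (1 - q) * h2 - q * h3)| <= M * (q * y ^+ 3 + q ^+ 2 * y ^+ 2).
    by rewrite normrM c11 mul1r.
  have H4 : `|q * c1 * (h4 - h3)| <= q * (M * (q' * y ^+ 2 + q' * y)).
    by rewrite 2!normrM c11 mulr1 (ger0_norm q0) ler_wpM2l.
  have -> : c0 + c1 * h1 - (1 - q) * (c0 + c1 * h2) - q * (c0 + c1 * h4) =
     c1 * (h1 - (1 - q) * h2 - q * h3) - q * c1 * (h4 - h3) by ring.
  apply: (le_trans (ler_normB _ _)); apply: (le_trans (lerD H3 H4)).
  have -> : q * (M * (q' * y ^+ 2 + q' * y)) = M * (q * (q' * y ^+ 2 + q' * y)) by ring.
  rewrite -mulrDr ler_wpM2l//.
  have : 0 <= q * q' * (y - y ^+ 2) by rewrite !mulr_ge0// subr_ge0.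
  have : 0 <= q ^+ 2 * (y - y ^+ 2) by rewrite mulr_ge0 ?sqr_ge0// subr_ge0.
  have : 0 <= q ^+ 2 * y by rewrite mulr_ge0 ?sqr_ge0.
  lra.
(* At the bottom, m_0 = 0 and m_1 = q_1 = 1: compared with smoothing at k + 1, [V 1] is off by y^2
   in time and [V 0] by y in space. *)
have Hd k : (B k.+1)%:R <= V 1 k + (eta + M * (2 * y)) /\
            (B k.+1)%:R <= V 0 k + (eta + M * (2 * y)).
  have := HB k.+1; rewrite /V qbarS qbar0 /qcoef hp1 subr0 !add0r mul0r addr0 addr0 mul1r.
  have e1 : e <= e + y ^+ 2 by rewrite lerDl.
  have := HL1 _ _ ((k.+1%:R - a) * y) ((k%:R + 1 - a) * y) (lexx e) e1.
  have := HL1 _ _ ((k.+1%:R - a) * y) ((k%:R - a) * y) (lexx e) (lexx e).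
  rewrite -natr1 !subrr normr0 add0r addr0.
  have -> : (k%:R + 1 - a) * y - (k%:R - a) * y = y by ring.
  have -> : e - (e + y ^+ 2) = - y ^+ 2 by ring.
  rewrite normrN (ger0_norm y0) (ger0_norm y2) !ler_norml => /andP[? ?] /andP[? ?] ?.
  have ? : M * y ^+ 2 <= M * y by rewrite ler_wpM2l.
  have ? : 0 <= M * y by rewrite mulr_ge0.
  by split; lra.
have H := pr_cycles_le HX HV n2 Hd.
apply: (le_trans H); rewrite /V add0r.
have Herr : \sum_(2 <= r < n) err r <= M * (qbar p n.-1 * y ^+ 3 + 2 * D * y).
  rewrite /err -mulr_sumr ler_wpM2l// big_split/= -mulr_suml.
  rewrite -mulr_suml -mulr_sumr; apply: lerD; last by rewrite ler_wpM2r// ler_wpM2l.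
  rewrite ler_wpM2r// /qbar prednK ?(ltnW n2)// [leRHS]big_ltn//.
  by rewrite lerDr; have /andP[] := @qcoef_itv 1 isT.
have e1 : e <= e + 1 by rewrite lerDl.
have := HL1 _ _ ((qbar p n.-1 - a) * y) 0 (eV n.-1) e1; rewrite subr0.
have -> : e + qbar p n.-1 * y ^+ 2 - (e + 1) = qbar p n.-1 * y ^+ 2 - 1 by ring.
rewrite ler_norml => /andP[_ ?]; rewrite /clt_error; lra.
Qed.
End normal_approximation.

(** * The limit theorem for a general centring and scale *)

Variable theta : R.
Hypothesis hq : (fun n : nat => n%:R * qcoef p n) @ \oo --> theta.

Lemma qcoef_le_inv : exists2 K : R, 0 <= K & forall n, (1 <= n)%N -> qcoef p n <= K / n%:R.
Proof.
have [K [_ HK]] : bounded_fun (fun n : nat => n%:R * qcoef p n).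
  by apply: cvg_seq_bounded; apply/cvg_ex; exists theta.
exists (`|K| + 1); first by rewrite addr_ge0.
move=> n n1; rewrite ler_pdivlMr ?ltr0n// mulrC.
apply: le_trans (ler_norm _) _; apply: HK => //.
by rewrite (le_lt_trans (ler_norm K))// ltrDl.
Qed.

(** As q_r <= K / r, each term is at most 2 K^2 / (r (r - 1)) = 2 K^2 (1 / (r - 1) - 1 / r), which
    telescopes. *)
Lemma sum_qcoef_mul_bounded : exists D : R, forall n,
  \sum_(2 <= r < n) qcoef p r * (qcoef p r + qcoef p r.-1) <= D.
Proof.
have [K K0 HK] := qcoef_le_inv.
exists (2 * K ^+ 2) => n; have [n2|n2] := leqP n 2.
  by rewrite big_geq// mulr_ge0// sqr_ge0.
suff H m : \sum_(2 <= r < m.+2) qcoef p r * (qcoef p r + qcoef p r.-1) <=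
    2 * K ^+ 2 * (1 - m.+1%:R^-1).
  have := H n.-2; have -> : n.-2.+2 = n by lia.
  move=> /le_trans; apply; apply: ler_piMr; first by rewrite mulr_ge0// sqr_ge0.
  by rewrite gerBl invr_ge0.
elim: m => [|m IH]; first by rewrite big_geq// invr1 subrr mulr0.
rewrite big_nat_recr//=; apply: le_trans (lerD IH (lexx _)) _.
have /andP[q0 _] := @qcoef_itv m.+2 isT; have /andP[q0' _] := @qcoef_itv m.+1 isT.
have Hq := HK m.+2 isT; have Hq' := HK m.+1 isT.
have m1 : 0 < (m.+1%:R : R) by rewrite ltr0n.
have m2 : 0 < (m.+2%:R : R) by rewrite ltr0n.
have Kle : K / m.+2%:R <= K / m.+1%:R by rewrite ler_wpM2l// lef_pV2 ?posrE// ler_nat.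
apply: (@le_trans _ _ (2 * K ^+ 2 * (1 - m.+1%:R^-1) + K / m.+2%:R * (2 * (K / m.+1%:R)))).
  rewrite lerD2l; apply: ler_pM => //; first by rewrite addr_ge0.
  by rewrite [leRHS]mulr_natl mulr2n lerD// (le_trans Hq).
rewrite le_eqVlt; apply/orP; left; apply/eqP.
move: m1; rewrite -[m.+2%:R]natr1; set u := m.+1%:R => u0; field.
by rewrite !gt_eqF// addr_gt0.
Qed.

Lemma clt_error_cvg0 M D (a s : nat -> R) :
  s @ \oo --> +oo ->
  (fun n => qbar p n.-1 / s n ^+ 2) @ \oo --> (1 : R) ->
  (fun n => (qbar p n.-1 - a n) / s n) @ \oo --> (0 : R) ->
  clt_error M D n (a n) (s n)^-1 @[n --> \oo] --> (0 : R).
Proof.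
move=> hs hv ha.
have hy : (s n)^-1 @[n --> \oo] --> (0 : R).
  apply/gtr0_cvgV0 => //.
  by move/cvgryPgt : hs; exact.
have h1 : `|qbar p n.-1 * (s n)^-1 ^+ 2 - 1| @[n --> \oo] --> (0 : R).
  rewrite -[X in _ --> X](normr0 R) -(subrr 1); apply: cvg_norm; apply: cvgB; last exact: cvg_cst.
  by under eq_fun do rewrite exprVn.
have h2 : `|(qbar p n.-1 - a n) * (s n)^-1| @[n --> \oo] --> (0 : R).
  by rewrite -[X in _ --> X](normr0 R); exact: cvg_norm.
have h3 : (2 + 2 * D) * (s n)^-1 @[n --> \oo] --> (0 : R).
  by rewrite -[X in _ --> X](mulr0 (2 + 2 * D)); apply: cvgMr.
have h4 : qbar p n.-1 * (s n)^-1 ^+ 3 @[n --> \oo] --> (0 : R).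
  rewrite -[X in _ --> X](mulr0 1); under eq_fun do rewrite exprSr mulrA exprVn.
  exact: cvgM.
rewrite /clt_error -[X in _ --> X](mulr0 M) -(addr0 0) -{1}(addr0 0) -{1}(addr0 0).
by apply: cvgMr; apply: cvgD => //; apply: cvgD => //; exact: cvgD.
Qed.

(** L is fixed before eps: moving the threshold by L eps puts the smoothing above or below the
    indicator up to a tail of [Phi] at L, and both the shift and the extra variance eps^2 vanish
    with eps. *)
Lemma Phi_shift_near x L eta : 0 < eta -> exists2 eps : R, 0 < eps &
  `|Phi ((x + L * eps) * (Num.sqrt (eps ^+ 2 + 1))^-1) - Phi x| <= eta /\
  `|Phi ((x + - L * eps) * (Num.sqrt (eps ^+ 2 + 1))^-1) - Phi x| <= eta.
Proof.
move=> eta0.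
have H c : \forall eps \near 0^'+,
    `|Phi ((x + c * eps) * (Num.sqrt (eps ^+ 2 + 1))^-1) - Phi x| <= eta.
  have cPhi : {for x, continuous (@Phi R)}.
    apply: differentiable_continuous; apply/derivable1_diffP.
    by have [] := is_derive_Phi x.
  have c0 : (x + c * eps) * (Num.sqrt (eps ^+ 2 + 1))^-1 @[eps --> (0 : R)] --> x.
    rewrite -[X in _ --> X]mulr1; apply: cvgM.
      rewrite [X in _ --> X](_ : x = x + c * 0); last by rewrite mulr0 addr0.
      apply: (@cvgD _ R^o _ _ _ (fun=> x) (fun eps => c * eps)); first exact: cvg_cst.
      by apply: cvgMr; exact: cvg_id.
    rewrite -[X in _ --> X]invr1; apply: cvgV; first exact: oner_neq0.
    rewrite [X in _ --> X](_ : 1 = Num.sqrt (0 ^+ 2 + 1)); last by rewrite expr0n add0r sqrtr1.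
    apply: (cvg_comp (fun eps => eps ^+ 2 + 1) Num.sqrt); last exact: sqrt_continuous.
    apply: (@cvgD _ R^o _ _ _ (fun eps => eps ^+ 2) (fun=> 1)); last exact: cvg_cst.
    exact: sqr_continuous.
  have h : \forall eps \near (0 : R),
      `|Phi ((x + c * eps) * (Num.sqrt (eps ^+ 2 + 1))^-1) - Phi x| <= eta.
    have := cvg_comp _ _ c0 cPhi => /cvgrPdist_le/(_ _ eta0).
    by apply: filterS => t; rewrite /= distrC.
  exact: cvg_within h.
near (0 : R)^'+ => eps.
by exists eps => //; split; near: eps; exact: H.
Unshelve. all: by end_near. Qed.

(** The distribution function at x is caught between smoothings with thresholds x - L eps and x + L
    eps. The three thirds of eta pay for the tails of [Phi], the shift of the threshold and
    [clt_error]. *)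
Lemma derangement_clt (d : nat -> measure_display) (T : forall n, measurableType (d n))
  (P : forall n, probability (T n) R) (X : forall n, nat -> {RV (P n) >-> bool})
  (a s : nat -> R) :
  (forall n, (2 <= n)%N -> derangement_process n p (X n)) ->
  s @ \oo --> +oo ->
  (fun n => qbar p n.-1 / s n ^+ 2) @ \oo --> (1 : R) ->
  (fun n => (qbar p n.-1 - a n) / s n) @ \oo --> (0 : R) ->
  cvg_in_distribution P (fun n => normalized (P n) (cycles (X n) n) (a n) (s n))
    (normal_prob 0 1).
Proof.
move=> hX hs hv ha x _.
rewrite [X in _ --> X](_ : _ = (Phi x)%:E); last exact: PhiE.
apply: cvg_EFin; first by apply: nearW => n; exact: fin_num_measure.
apply/cvgrPdist_le => eta eta0.
have eta3 : 0 < eta / 3 by lra.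
have [L L0 [PhiN PhiL]] := Phi_tails eta3.
have [eps eps0 [HepsL HepsN]] := Phi_shift_near x L eta3.
pose e := eps ^+ 2.
have e0 : 0 < e by rewrite exprn_gt0.
have sqe : Num.sqrt e = eps by rewrite sqrtr_sqr gtr0_norm.
have [ML ML0 HL] := heat_lipschitz e0.
have [MS MS0 HS] := heat_bernoulli_step e0.
have [D HD] := sum_qcoef_mul_bounded.
pose M := ML + MS.
have M0 : 0 <= M by rewrite addr_ge0.
have HL' b t t' u u' : e <= t -> e <= t' ->
  `|heat b t u - heat b t' u'| <= M * (`|t - t'| + `|u - u'|).
  move=> es es'; apply: (le_trans (HL _ _ _ _ _ es es')).
  by rewrite ler_wpM2r ?addr_ge0// lerDl.
have HS' b t u y q : e <= t -> 0 <= y <= 1 -> 0 <= q <= 1 ->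
  `|heat b (t + q * y ^+ 2) (u + q * y) - (1 - q) * heat b t u
      - q * heat b t (u + y)| <= M * (q * y ^+ 3 + q ^+ 2 * y ^+ 2).
  move=> es y01 q01; apply: (le_trans (HS _ _ _ _ _ es y01 q01)).
  have /andP[? _] := y01; have /andP[? _] := q01.
  by rewrite ler_wpM2r ?lerDr// addr_ge0// mulr_ge0 ?exprn_ge0.
have := cvgr_le 0 (clt_error_cvg0 M D hs hv ha) (eta / 3) eta3.
have s1 : \forall n \near \oo, 1 <= s n by move/cvgryPge : hs; exact.
move=> herr; near=> n.
have n2 : (2 <= n)%N by near: n; exact: nbhs_infty_ge.
have sn1 : 1 <= s n by near: n.
have err : clt_error M D n (a n) (s n)^-1 <= eta / 3 by near: n; exact: herr.
have sn0 : 0 < s n by exact: lt_le_trans sn1.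
have y01 : 0 <= (s n)^-1 <= 1 by rewrite invr_ge0 ltW//= invf_le1.
pose B : pred nat := fun k => (k%:R - a n) / s n <= x.
pose S := [set t | B (\sum_(1 <= i < n.+1) X n i t)%N].
have SE : S = normalized (P n) (cycles (X n) n) (a n) (s n) @^-1` `]-oo, x].
  apply/seteqP.
  by split=> t; rewrite /= in_itv/= /normalized /cycles /S /B/= natr_sum.
have cdfE : @cdf _ _ _ (P n) (normalized (P n) (cycles (X n) n) (a n) (s n)) x = P n S.
  by rewrite SE.
have mS : measurable S.
  rewrite SE -[X in measurable X]setTI.
  by apply: (measurable_funP (normalized (P n) (cycles (X n) n) (a n) (s n))).
rewrite [(_ \o _) n]/= cdfE -/(pr (P n) S).
(* A shift of the threshold by c standard deviations of the smoothing adds c to the argument of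
   [Phi]. *)
have heatE (c : R) (w : R) : heat (x + c * eps) e w = Phi ((x - w) / eps + c).
  by rewrite /heat sqe; congr Phi; field; rewrite gt_eqF.
have heat1 (c : R) : heat (x + c * eps) (e + 1) 0 =
    Phi ((x + c * eps) * (Num.sqrt (eps ^+ 2 + 1))^-1).
  by rewrite /heat subr0.
have up : pr (P n) S <= 0 + 1 * heat (x + L * eps) (e + 1) 0 + eta / 3 + eta / 3.
  apply: le_trans (@pr_cycles_le_heat e M D M0 HL' HS' HD _ _ (P n) n (X n) B
    (a n) (s n)^-1 (x + L * eps) 0 1 (eta / 3) n2 (hX _ n2) y01 (normr1 _) _) _.
    move=> k; rewrite add0r mul1r heatE /B; case: (leP ((k%:R - a n) / s n) x) => kx; last first.
      by rewrite mulr0n addr_ge0 ?Phi_ge0// ltW.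
    rewrite mulr1n.
    have : Phi L <= Phi ((x - (k%:R - a n) / s n) / eps + L).
      by apply: Phi_nondecreasing; rewrite lerDr divr_ge0 ?subr_ge0// ltW.
    lra.
  by rewrite lerD2l.
(* The lower bound on P(S) is an upper bound on the complement, where the argument of [Phi] is at
   most -L. *)
have lo : pr (P n) (~` S) <= 1 + -1 * heat (x + - L * eps) (e + 1) 0 + eta / 3 + eta / 3.
  have -> : ~` S = [set t | predC B (\sum_(1 <= i < n.+1) X n i t)%N].
    by apply/seteqP; split=> t /negP.
  apply: le_trans (@pr_cycles_le_heat e M D M0 HL' HS' HD _ _ (P n) n (X n) (predC B)
    (a n) (s n)^-1 (x + - L * eps) 1 (-1) (eta / 3) n2 (hX _ n2) y01 _ _) _.
  - by rewrite normrN normr1.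
  - move=> k; rewrite mulN1r heatE /B/=; case: (leP ((k%:R - a n) / s n) x) => kx; rewrite ?mulr0n ?mulr1n.
      have := Phi_le1 ((x - (k%:R - a n) / s n) / eps + - L); lra.
    have : Phi ((x - (k%:R - a n) / s n) / eps + - L) <= Phi (- L).
      apply: Phi_nondecreasing; rewrite gerDr pmulr_lle0 ?invr_gt0// subr_le0.
      exact: ltW.
    lra.
  - by rewrite lerD2l.
move: up lo; rewrite pr_setC// !heat1.
move: HepsL HepsN; rewrite !ler_norml => /andP[? ?] /andP[? ?] ? ?; apply/andP; split; lra.
Unshelve. all: by end_near.
Qed.

End parameters.

(** * Harmonic sums, logarithms and sums of powers *)

Section asymptotics.
Context {R : realType}.

Definition harmonic_sum (n : nat) : R := \sum_(1 <= i < n.+1) i%:R^-1.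

(** Induction with ln (1 + u) <= u at u = 1 / (n + 1); the reverse comparison [harmonic_sum_le_ln]
    takes u = -1 / (n + 2). *)
Lemma ln_le_harmonic_sum n : ln n.+1%:R <= harmonic_sum n.
Proof.
elim: n => [|n IH]; first by rewrite ln1 /harmonic_sum big_geq.
rewrite /harmonic_sum big_nat_recr//= -/(harmonic_sum n).
have n1 : 0 < (n.+1%:R : R) by rewrite ltr0n.
have -> : (n.+2%:R : R) = n.+1%:R * (1 + n.+1%:R^-1).
  by rewrite mulrDr mulr1 divff ?gt_eqF// natr1.
have u0 : 0 < (n.+1%:R^-1 : R) by rewrite invr_gt0.
rewrite lnM ?posrE ?addr_gt0//.
by rewrite lerD// le_ln1Dx// (lt_trans _ u0)// ltrN10.
Qed.

Lemma harmonic_sum_le_ln n : harmonic_sum n.+1 <= 1 + ln n.+1%:R.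
Proof.
elim: n => [|n IH]; first by rewrite ln1 /harmonic_sum big_nat1 invr1 addr0.
rewrite /harmonic_sum big_nat_recr//= -/(harmonic_sum n.+1).
have n1 : 0 < (n.+1%:R : R) by rewrite ltr0n.
have n2 : 0 < (n.+2%:R : R) by rewrite ltr0n.
have E : (n.+1%:R : R) = n.+2%:R * (1 + - n.+2%:R^-1).
  by rewrite mulrDr mulr1 mulrN divff ?gt_eqF// -[n.+2%:R]natr1 addrK.
have u1 : n.+2%:R^-1 < (1 : R) by rewrite invf_lt1// ltr1n.
have H : ln (1 + - n.+2%:R^-1) <= - (n.+2%:R^-1 : R) by rewrite le_ln1Dx// ltrN2.
have L : ln (n.+1%:R : R) <= ln n.+2%:R - n.+2%:R^-1.
  by rewrite E lnM ?posrE ?subr_gt0// lerD2l.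
apply: (le_trans (lerD IH (lexx _))); rewrite -addrA lerD2l.
by rewrite -lerBrDr.
Qed.

Lemma cvg_ln_nat : ln (n%:R : R) @[n --> \oo] --> +oo.
Proof.
apply/cvgryPge => A; near=> n.
have An : expR A <= n%:R by near: n; exact: nbhs_infty_ger.
rewrite -[A]expRK ler_ln ?posrE ?expR_gt0//.
exact: lt_le_trans (expR_gt0 A) An.
Unshelve. all: by end_near. Qed.

Lemma cvg_sqrty (T : Type) (F : set_system T) (FF : Filter F) (u : T -> R) :
  u @ F --> +oo -> Num.sqrt (u t) @[t --> F] --> +oo.
Proof.
move=> /cvgryPge hu; apply/cvgryPge => A.
apply: filterS (hu (A ^+ 2)) => t ut.
by rewrite (le_trans (ler_norm A))// -sqrtr_sqr ler_wsqrtr.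
Qed.

(** Since (1 - 1/(n+1))^(-c) >= 1 + c / (n + 1), the difference on the right is at least n^(-c) c /
    (n + 1 + c), and n + 1 + c <= (2 + c) n. *)
Lemma powRN_telescope (c : R) (n : nat) : 0 < c -> (1 <= n)%N ->
  n%:R `^ (- c) / n%:R <= (2 + c) / c * (n%:R `^ (- c) - n.+1%:R `^ (- c)).
Proof.
move=> c0 n1.
have n0 : 1 <= (n%:R : R) by rewrite ler1n.
have n0' : 0 < (n%:R : R) by rewrite ltr0n.
have v0 : 0 < n.+1%:R^-1 :> R by rewrite invr_gt0 ltr0n.
have u0 : 0 < c * n.+1%:R^-1 by rewrite mulr_gt0.
have h : n.+1%:R `^ (- c) <= n%:R `^ (- c) / (1 + c * n.+1%:R^-1).
  have E : (n%:R : R) = n.+1%:R * (1 + - n.+1%:R^-1).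
    by rewrite mulrDr mulr1 mulrN divff ?pnatr_eq0// -natr1 addrK.
  have w0 : 0 < 1 + - (n.+1%:R^-1 : R) by rewrite subr_gt0 invf_lt1 ?ltr0n// ltr1n.
  rewrite ler_pdivlMr ?addr_gt0// [in leRHS]E powRM ?ler0n ?(ltW w0)//.
  rewrite ler_wpM2l ?powR_ge0// /powR gt_eqF//.
  apply: le_trans (expR_ge1Dx _) _; rewrite ler_expR.
  have H : ln (1 + - n.+1%:R^-1) <= - (n.+1%:R^-1 : R).
    by rewrite le_ln1Dx// ltrN2 invf_lt1 ?ltr0n// ltr1n.
  by rewrite mulNr -mulrN ler_pM2l// lerNr.
have P0 := powR_ge0 (n%:R : R) (- c).
have h2 : n%:R^-1 <= (2 + c) / c * (1 - (1 + c * n.+1%:R^-1)^-1) :> R.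
  rewrite -[n.+1%:R]natr1; set x := n%:R in n0 n0' *.
  have -> : (2 + c) / c * (1 - (1 + c * (x + 1)^-1)^-1) = (2 + c) / (x + 1 + c).
    by field; rewrite !gt_eqF// ?addr_gt0//; lra.
  rewrite ler_pdivlMr; last by lra.
  rewrite mulrC ler_pdivrMr//; nra.
apply: (le_trans (ler_wpM2l P0 h2)).
rewrite mulrCA ler_wpM2l//; first by rewrite divr_ge0 ?addr_ge0// ltW.
by rewrite mulrBr mulr1 lerB.
Qed.

Lemma sum_powRN_le (c : R) (N n : nat) : 0 < c -> (1 <= N)%N ->
  \sum_(N <= i < n) i%:R `^ (- c) / i%:R <= (2 + c) / c * N%:R `^ (- c).
Proof.
move=> c0 N1; have k0 : 0 <= (2 + c) / c by rewrite divr_ge0 ?addr_ge0// ltW.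
have [nN|Nn] := leqP n N; first by rewrite big_geq// mulr_ge0 ?powR_ge0.
apply: (@le_trans _ _ (\sum_(N <= i < n) (2 + c) / c *
    (i%:R `^ (- c) - i.+1%:R `^ (- c)))).
  rewrite big_nat [leRHS]big_nat; apply: ler_sum => i /andP[Ni _].
  by apply: powRN_telescope => //; exact: leq_trans Ni.
rewrite -mulr_sumr ler_wpM2l//.
under eq_bigr do rewrite -opprB.
by rewrite sumrN telescope_sumr ?(ltnW Nn)// opprB lerBlDr lerDl powR_ge0.
Qed.

(** * Growth of the centring and boundedness of the partial sums of psi *)

Variables (p : nat -> R) (theta : R).
Hypothesis hp1 : p 1%N = 0.
Hypothesis hp2 : p 2%N = 1.
Hypothesis hp : forall i, (3 <= i)%N -> 0 < p i < 1.
Hypothesis htheta : 0 < theta.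
Hypothesis hq : (fun n : nat => n%:R * qcoef p n) @ \oo --> theta.

Lemma psi_partialE n : psi_partial theta p n = qbar p n - theta * harmonic_sum n.
Proof. by rewrite /psi_partial /qbar sumrB -mulr_sumr. Qed.

(** Eventually q_n >= theta / (2 n), so [qbar] dominates half of theta times the harmonic sum up to
    the constant C of the first N terms. *)
Lemma cvg_qbary : qbar p n @[n --> \oo] --> +oo.
Proof.
have t2 : theta / 2 < theta by rewrite gtr_pMr// invf_lt1// ltr1n.
have [N _ HN] := cvgr_ge theta hq (theta / 2) t2.
pose C := qbar p N - theta / 2 * harmonic_sum N.
have H m : theta / 2 * harmonic_sum (N + m) + C <= qbar p (N + m).
  elim: m => [|m IH]; first by rewrite addn0 /C addrC subrK.
  rewrite addnS qbarS /harmonic_sum big_nat_recr//= -/(harmonic_sum (N + m)).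
  have := HN (N + m).+1 (leqW (leq_addr _ _)) => /= h.
  have h' : theta / 2 * (N + m).+1%:R^-1 <= qcoef p (N + m).+1.
    by rewrite ler_pdivrMr ?ltr0n// [leRHS]mulrC.
  by rewrite mulrDr addrAC lerD.
apply/cvgryPge => A.
have := cvg_ln_nat => /cvgryPge/(_ ((A - C) / (theta / 2))) hl.
near=> n.
have Nn : (N < n)%N by near: n; exact: nbhs_infty_gt.
have := H (n - N)%N; rewrite subnKC ?(ltnW Nn)//; apply: le_trans.
rewrite -lerBlDr mulrC -ler_pdivrMr ?divr_gt0//.
apply: (@le_trans _ _ (ln n%:R)); first by near: n.
apply: le_trans (ln_le_harmonic_sum n).
by rewrite ler_ln ?posrE ?ltr0n ?ler_nat// (leq_ltn_trans _ Nn).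
Unshelve. all: by end_near. Qed.

(** A bounded error in the centring is negligible against both a and sqrt a, as a tends to infinity.
    Taken with a = [qbar p] and with a = theta log n. *)
Lemma derangement_clt_bounded (d : nat -> measure_display)
  (T : forall n, measurableType (d n)) (P : forall n, probability (T n) R)
  (X : forall n, nat -> {RV (P n) >-> bool}) (a : nat -> R) (K : R) :
  (forall n, (2 <= n)%N -> derangement_process n p (X n)) ->
  a @ \oo --> +oo -> (\forall n \near \oo, `|qbar p n - a n| <= K) ->
  cvg_in_distribution P (fun n => normalized (P n) (cycles (X n) n) (a n)
    (Num.sqrt (a n))) (normal_prob 0 1).
Proof.
move=> hX ha hK.
(* Passing from n to n - 1 costs q_n <= 1. *)
have hK1 : \forall n \near \oo, `|qbar p n.-1 - a n| <= K + 1.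
  near=> n.
  have n1 : (0 < n)%N by near: n; exact: nbhs_infty_gt.
  have h : `|qbar p n - a n| <= K by near: n.
  have E : qbar p n = qbar p n.-1 + qcoef p n by rewrite -[in LHS](prednK n1) qbarS prednK.
  have /andP[q0 q1] := qcoef_itv hp1 hp2 hp n1.
  rewrite (_ : _ - _ = (qbar p n - a n) - qcoef p n); last by rewrite E; ring.
  by apply: (le_trans (ler_normB _ _)); rewrite lerD// ger0_norm.
have apos : \forall n \near \oo, 0 < a n by move/cvgryPgt : ha; exact.
have small (v : nat -> R) : v @ \oo --> +oo ->
    (qbar p n.-1 - a n) / v n @[n --> \oo] --> (0 : R).
  move=> hv.
  have vpos : \forall n \near \oo, 0 < v n by move/cvgryPgt : hv; exact.
  have hv0 : (K + 1) * (v n)^-1 @[n --> \oo] --> (0 : R).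
    rewrite -[X in _ --> X](mulr0 (K + 1)); apply: cvgMr.
    exact/gtr0_cvgV0.
  apply/norm_cvg0P; apply: (@squeeze_cvgr _ _ _ _ (fun=> 0) _ _ _ _ (cvg_cst 0) hv0).
  near=> n; rewrite normr_ge0/= normrM.
  have vn : 0 < v n by near: n.
  by rewrite (@gtr0_norm _ (v n)^-1) ?invr_gt0// ler_wpM2r ?invr_ge0 ?(ltW vn)//; near: n.
apply: (derangement_clt hp1 hp2 hp hq) => //.
- exact: cvg_sqrty.
- have h0 : 1 + (qbar p n.-1 - a n) / a n @[n --> \oo] --> (1 : R).
    rewrite -[X in _ --> X]addr0; apply: (@cvgD _ R^o _ _ _ (fun=> 1)); first exact: cvg_cst.
    exact: small.
  apply: cvg_trans h0; apply: near_eq_cvg; near=> n.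
  have an : 0 < a n by near: n.
  by rewrite sqr_sqrtr ?(ltW an)//; field; rewrite gt_eqF.
- by apply: small; exact: cvg_sqrty.
Unshelve. all: by end_near. Qed.

(** The additional theta comes from 0 <= H_n - log n <= 1, with H_n the harmonic sum. *)
Lemma qbar_sub_ln_bounded (K : R) :
  (\forall n \near \oo, `|psi_partial theta p n| <= K) ->
  \forall n \near \oo, `|qbar p n - theta * ln n%:R| <= K + theta.
Proof.
move=> hK; near=> n.
have n1 : (0 < n)%N by near: n; exact: nbhs_infty_gt.
have h : `|psi_partial theta p n| <= K by near: n.
rewrite (_ : _ - _ = psi_partial theta p n + theta * (harmonic_sum n - ln n%:R)); last first.
  by rewrite psi_partialE; ring.
apply: (le_trans (ler_normD _ _)); rewrite lerD// normrM gtr0_norm// ler_piMr ?(ltW htheta)//.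
have l1 : ln (n%:R : R) <= harmonic_sum n.
  by apply: le_trans (ln_le_harmonic_sum n); rewrite ler_ln ?posrE ?ltr0n ?ler_nat.
have l2 : harmonic_sum n <= 1 + ln n%:R.
  by have := harmonic_sum_le_ln n.-1; rewrite prednK.
rewrite ler_norml; apply/andP; split; lra.
Unshelve. all: by end_near. Qed.

(** The terms are absolutely summable: q_i - theta / i is the sum of (theta_i - theta) p_i / (i -
    1), of order i^(-c-1), and theta (1 - i q_i) / (i (i - 1)), of order i^(-2). *)
Lemma psi_partial_bounded (c : R) : 0 < c ->
  asymp_equiv (fun n : nat => `|theta_coef p n - theta|)
              (fun n : nat => n%:R `^ (- c)) ->
  exists K, \forall n \near \oo, `|psi_partial theta p n| <= K.
Proof.
move=> c0 [c1 [C [_ C0 [N0 _ HN0]]]].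
have [K K0 HK] := qcoef_le_inv hq.
pose N := maxn N0 3.
have term i : (N <= i)%N -> `|qcoef p i - theta / i%:R| <=
    2 * C * (i%:R `^ (- c) / i%:R) + 2 * theta * (1 + K) * (i%:R `^ (- 1) / i%:R).
  rewrite /N geq_max => /andP[N0i i3].
  have i1 : (1 <= i)%N by exact: leq_trans i3.
  have /andP[p0 p1] := hp i3.
  have i0 : 3 <= (i%:R : R) by rewrite (ler_nat R 3).
  have b0 : 0 < (i%:R : R) `^ (- c) by rewrite powR_gt0//; lra.
  have /andP[_] := HN0 i N0i; rewrite /= ler_pdivrMr// => th.
  have q1 := HK i i1.
  have /andP[q0 _] := qcoef_itv hp1 hp2 hp i1.
  rewrite powR_inv1 ?ler0n//.
  move: b0 th q1; set b := _ `^ _; set D := theta_coef p i - theta.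
  move: i0; set x := i%:R => x3 b0 th q1.
  have x0 : 0 < x by lra.
  have -> : qcoef p i - theta / x = D * (p i / (x - 1)) +
      theta * ((1 - x * qcoef p i) / (x * (x - 1))).
    rewrite /D /theta_coef -/x /qcoef; field.
    by rewrite !gt_eqF//; lra.
  apply: (le_trans (ler_normD _ _)); apply: lerD.
    rewrite (_ : 2 * C * (b / x) = C * b * (2 / x)); last by field; rewrite gt_eqF.
    rewrite normrM ler_pM// ger0_norm; last by rewrite divr_ge0//; lra.
    rewrite ler_pdivrMr; last by lra.
    by rewrite mulrAC ler_pdivlMr//; nra.
  rewrite (_ : 2 * theta * (1 + K) * (x^-1 / x) = theta * ((1 + K) * (2 / (x * x)))); last first.
    by field; rewrite gt_eqF.
  rewrite normrM gtr0_norm// ler_pM2l// normrM.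
  have xq0 : 0 <= x * qcoef p i by rewrite mulr_ge0// ltW.
  have xqK : x * qcoef p i <= K by rewrite mulrC -ler_pdivlMr.
  apply: ler_pM => //; first by rewrite ler_norml; apply/andP; split; lra.
  rewrite ger0_norm; last by rewrite invr_ge0 mulr_ge0//; lra.
  rewrite ler_pdivlMr ?mulr_gt0// mulrC ler_pdivrMr; last by rewrite mulr_gt0//; lra.
  nra.
exists (`|psi_partial theta p N.-1| + 2 * C * ((2 + c) / c * N%:R `^ (- c)) +
  2 * theta * (1 + K) * ((2 + 1) / 1 * N%:R `^ (- 1))).
near=> n.
have Nn : (N <= n)%N by near: n; exact: nbhs_infty_ge.
have N1 : (1 <= N)%N by rewrite /N; lia.
rewrite {1}/psi_partial (@big_cat_nat _ _ _ N)//=; last exact: leqW.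
rewrite -addrA; apply: (le_trans (ler_normD _ _)); apply: lerD.
  by rewrite /psi_partial prednK.
apply: (le_trans (ler_norm_sum _ _ _)).
apply: (@le_trans _ _ (\sum_(N <= i < n.+1)
   (2 * C * (i%:R `^ (- c) / i%:R) + 2 * theta * (1 + K) * (i%:R `^ (- 1) / i%:R)))).
  by rewrite big_nat [leRHS]big_nat; apply: ler_sum => i /andP[+ _]; exact: term.
rewrite big_split/= -!mulr_sumr; apply: lerD.
  by rewrite ler_wpM2l ?sum_powRN_le// mulr_ge0// ltW.
by rewrite ler_wpM2l ?sum_powRN_le// !mulr_ge0 ?addr_ge0// ltW.
Unshelve. all: by end_near.
Qed.

End asymptotics.

Theorem corollary4 (R : realType) (p : nat -> R) (theta : R)
  (d : nat -> measure_display) (T : forall n, measurableType (d n))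
  (P : forall n, probability (T n) R)
  (X : forall n, nat -> {RV (P n) >-> bool})
  (hp1 : p 1%N = 0) (hp2 : p 2%N = 1)
  (hp : forall i, (3 <= i)%N -> 0 < p i < 1)
  (hX : forall n, (2 <= n)%N -> derangement_process n p (X n))
  (htheta : 0 < theta)
  (hq : (fun n : nat => n%:R * qcoef p n) @ \oo --> theta) :
  let CLT := cvg_in_distribution P (fun n : nat =>
    normalized (P n) (cycles (X n) n) (theta * ln n%:R) (Num.sqrt (theta * ln n%:R)))
    (normal_prob 0 1) in
  [/\ cvg_in_distribution P (fun n : nat =>
        normalized (P n) (cycles (X n) n) (qbar p n) (Num.sqrt (qbar p n)))
        (normal_prob 0 1),
      cvgn (psi_partial theta p) -> CLT &
      (exists2 c : R, 0 < c &
        asymp_equiv (fun n : nat => `|theta_coef p n - theta|)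
                    (fun n : nat => n%:R `^ (- c))) -> CLT].
Proof.
move=> CLT.
(* Both conditions for the logarithmic centring are used only through boundedness of the partial
   sums of psi. *)
have clt_log K : (\forall n \near \oo, `|psi_partial theta p n| <= K) -> CLT.
  move=> hK; apply: (derangement_clt_bounded hp1 hp2 hp hq hX _
    (qbar_sub_ln_bounded htheta hK)).
  apply: (cvg_comp _ _ (@cvg_ln_nat R)).
  by apply: (gt0_cvgMry htheta); exact: cvg_id.
split.
- apply: (derangement_clt_bounded (K := 0) hp1 hp2 hp hq hX).
    exact: cvg_qbary htheta hq.
  by apply: nearW => n; rewrite subrr normr0.
- move=> /cvg_seq_bounded[M [_ HM]]; apply: (clt_log (`|M| + 1)).
  apply: nearW => n; apply: HM => //.
  by rewrite (le_lt_trans (ler_norm M))// ltrDl.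
- move=> [c c0 /(psi_partial_bounded hp1 hp2 hp htheta hq c0)[K hK]].
  exact: clt_log hK.
Qed.
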